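(* Let $\mathcal{M}^2$ be the set of matroid isomorphism classes (including those with loops) of rank two matroids. Let $\mathrm{Mat}_c$ be the vector subspace of $\mathrm{Mat}$ spanned by the isomorphism classes of connected matroids, and let $\mathcal{M}^2_c$ be the set of matroid isomorphism classes of connected rank two matroids. Then the algebra morphism $F:\mathrm{Mat}\to\mathrm{QSym}$ is injective when restricted to $\mathcal{M}^2$, and the induced quotient map of vector spaces $\overline{F}:\mathrm{Mat}_c\to\mathrm{QSym}/\mathfrak{m}^2$ is injective when restricted to $\mathcal{M}^2_c$.
   Context: A composition is a finite sequence $\alpha=(\alpha_1,\dots,\alpha_m)$ of positive integers, with weight $|\alpha|=\sum\alpha_i$. For compositions of the same weight $n$, $\beta\preccurlyeq\alpha$ ($\beta$ refines $\alpha$) if the set of proper partial sums of $\alpha$ is contained in that of $\beta$. $\mathrm{QSym}$ is the ring of quasisymmetric functions with rational coefficients in ordered variables $x_1,x_2,\dots$, with monomial basis $\mathbf{x}^\alpha=\sum_{i_1<\cdots<i_m}x_{i_1}^{\alpha_1}\cdots x_{i_m}^{\alpha_m}$ and fundamental basis $L_\alpha=\sum_{\beta\preccurlyeq\alpha}\mathbf{x}^\beta$. $\mathrm{QSym}_d$ is its homogeneous component of degree $d$, and $\mathfrak{m}=\bigoplus_{d\ge1}\mathrm{QSym}_d$. For a poset $P$ on a finite set of positive integers (a labeled poset), $F(P)=\sum_\pi L_{C(\pi)}$, summed over all linear extensions $\pi$ of $P$ (sequences listing each label once, with $x$ before $y$ whenever $x<_P y$), where $C(\pi)$ is the composition of lengths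 of successive maximal increasing runs of $\pi$. For a matroid $M$ with ground set $E(M)$ and bases $\mathcal{B}(M)$, and $B\in\mathcal{B}(M)$, let $P_B$ be the poset on $E(M)$ with $e<_{P_B}e'$ iff $e\in B$, $e'\notin B$ and $(B\setminus\{e\})\cup\{e'\}\in\mathcal{B}(M)$, given any strict labeling (i.e. one for which $x<_{P_B}y$ implies label of $x$ $>$ label of $y$; the choice does not affect $F(P_B)$). Then $F(M)=\sum_{B\in\mathcal{B}(M)}F(P_B)$; it depends only on the isomorphism class $[M]$. $\mathrm{Mat}$ is the $\mathbb{Q}$-algebra with basis the isomorphism classes of (finite) matroids and product $[M_1]\cdot[M_2]=[M_1\oplus M_2]$ (direct sum). The linear extension of $[M]\mapsto F(M)$ is an algebra morphism $F:\mathrm{Mat}\to\mathrm{QSym}$. The map $\overline{F}:\mathrm{Mat}_c\to\mathrm{QSym}/\mathfrak{m}^2$ is the restriction of $F$ to $\mathrm{Mat}_c$ followed by the quotient map $\mathrm{QSym}\to\mathrm{QSym}/\mathfrak{m}^2$. *)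

(* Defs.v *)
From HB Require Import structures.
From mathcomp Require Import all_boot all_order all_algebra.
From mathcomp Require Import finmap boolp classical_sets functions.
From mathcomp Require Import monalg.
From mathcomp Require Import fintype finset.

Set Implicit Arguments.
Unset Strict Implicit.
Unset Printing Implicit Defensive.

Import GRing.Theory.
Local Open Scope ring_scope.

(* A formal power series in the ordered variables x_0, x_1, ..., given by its
   coefficients: the exponent sequence e = [:: e_0; ...; e_(k-1)] stands for the
   monomial x_0^e_0 ... x_(k-1)^e_(k-1).  Exponent sequences that differ by
   trailing zeros denote the same monomial; a pseries is a genuine power series
   when it takes the same value on them, which quasisymmetric below entails.
   The ring structure of interest is pmul, not the pointwise product. *)
Definition pseries : Type := seq nat -> rat.
Identity Coercion fun_of_pseries : pseries >-> Funclass.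
HB.instance Definition _ := GRing.Lmodule.copy pseries (seq nat -> rat^o).

(* For i_1 < ... < i_m and positive a_1, ..., a_m, nonzero maps every exponent
   sequence of x_(i_1)^a_1 ... x_(i_m)^a_m to the composition (a_1, ..., a_m). *)
Definition nonzero (e : seq nat) : seq nat := [seq k <- e | (0 < k)%N].

Definition quasisymmetric (f : pseries) : Prop :=
  forall d e, nonzero d = nonzero e -> f d = f e.

Definition bounded_degree (f : pseries) : Prop :=
  exists D, forall e, (D < sumn e)%N -> f e = 0.

(* The pairs (d1, d2) of exponent sequences of the length of e with d1 + d2 = e
   entrywise (see mem_splits), i.e. the factorizations of the monomial e. *)
Fixpoint splits (e : seq nat) : seq (seq nat * seq nat) :=
  if e is k :: e' then
    [seq (i :: p.1, (k - i)%N :: p.2) | i <- iota 0 k.+1, p <- splits e']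
  else [:: ([::], [::])].

Definition pmul (f g : pseries) : pseries :=
  fun e => \sum_(p <- splits e) f p.1 * g p.2.

(* The sum of all x_(i_1)^al_1 ... x_(i_m)^al_m with i_1 < ... < i_m. *)
Definition pmonomial (al : seq nat) : pseries :=
  fun e => (nonzero e == al)%:R.

Lemma splits_cons k e : splits (k :: e) =
  [seq (i :: p.1, (k - i)%N :: p.2) | i <- iota 0 k.+1, p <- splits e].
Proof. by []. Qed.

Lemma mem_splits e p :
  (p \in splits e) = [&& size p.1 == size e, size p.2 == size e &
                      all2 (fun a k => a.1 + a.2 == k)%N (zip p.1 p.2) e].
Proof.
elim: e p => [|k e IH] [d1 d2].
  by rewrite inE; case: d1 => [|a d1]; case: d2 => [|b d2].
rewrite splits_cons; apply/allpairsPdep/idP => [[i [q [+ + [-> ->]]]]|].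
  rewrite mem_iota add0n ltnS IH /= !eqSS => /subnKC-> /and3P[-> -> ->].
  by rewrite eqxx.
case/and3P; case: d1 => [//|a d1]; case: d2 => [//|b d2].
move=> s1 s2 /andP[/eqP<- h]; have de : (d1, d2) \in splits e by rewrite IH; apply/and3P.
exists a, (d1, d2); split.
- by rewrite mem_iota add0n ltnS /= leq_addr.
- exact: de.
- by rewrite /= addKn.
Qed.

Lemma sumn_splits e p : p \in splits e -> (sumn p.1 + sumn p.2 = sumn e)%N.
Proof.
elim: e p => [|k e IH] p; first by rewrite inE => /eqP->.
rewrite splits_cons; case/allpairsPdep=> i [q [+ /IH /= <- ->]].
by rewrite mem_iota add0n ltnS /= => hi; rewrite addnACA subnKC.
Qed.

Definition ptail (i : nat) (f : pseries) : pseries := fun e => f (i :: e).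

Lemma pmul_nil f g : pmul f g [::] = f [::] * g [::].
Proof. by rewrite /pmul big_seq1. Qed.

Lemma pmul_cons f g k e :
  pmul f g (k :: e) = \sum_(i < k.+1) pmul (ptail i f) (ptail (k - i) g) e.
Proof.
rewrite /pmul big_allpairs_dep /= -[RHS](big_mkord xpredT
  (fun i => \sum_(p <- splits e) f (i :: p.1) * g ((k - i)%N :: p.2))).
by rewrite /index_iota subn0.
Qed.

Lemma pmulDl f1 f2 g e : pmul (f1 + f2) g e = pmul f1 g e + pmul f2 g e.
Proof. by rewrite /pmul -big_split; apply: eq_bigr => p _ /=; rewrite -mulrDl. Qed.

Lemma pmul_suml n (f : 'I_n -> pseries) g e :
  pmul (fun d => \sum_i f i d) g e = \sum_i pmul (f i) g e.
Proof.
by rewrite /pmul exchange_big; apply: eq_bigr => p _ /=; rewrite mulr_suml.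
Qed.

Lemma pmulC f g : pmul f g = pmul g f.
Proof.
apply/funext => e; elim: e f g => [|k e IH] f g; first by rewrite !pmul_nil mulrC.
rewrite !pmul_cons (reindex_inj rev_ord_inj) /=; apply: eq_bigr => i _.
by rewrite IH subSS subKn // -ltnS.
Qed.

Lemma pmul_sumr n (f : 'I_n -> pseries) g e :
  pmul g (fun d => \sum_i f i d) e = \sum_i pmul g (f i) e.
Proof. by rewrite pmulC pmul_suml; apply: eq_bigr => i _; rewrite pmulC. Qed.

Lemma sum_triangle k (H : nat -> nat -> rat) :
  \sum_(i < k.+1) \sum_(j < (k - i).+1) H i j =
  \sum_(i < k.+1) \sum_(j < i.+1) H j (i - j)%N.
Proof.
elim: k => [|k IH]; first by rewrite !big_ord1.
rewrite [RHS]big_ord_recr /= -IH [LHS]big_ord_recr /= subnn big_ord1.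
rewrite [X in _ = _ + X]big_ord_recr /= subnn addrA -big_split; congr (_ + _).
apply: eq_bigr => i _.
by rewrite subSn ?big_ord_recr // -ltnS.
Qed.

Lemma pmulA f g h : pmul f (pmul g h) = pmul (pmul f g) h.
Proof.
apply/funext => e; elim: e f g h => [|k e IH] f g h.
  by rewrite !pmul_nil mulrA.
rewrite !pmul_cons.
have tailM i u v : ptail i (pmul u v) =
    fun d => \sum_(j < i.+1) pmul (ptail j u) (ptail (i - j) v) d.
  by apply/funext => d; rewrite /ptail pmul_cons.
under eq_bigr => i _ do (rewrite tailM pmul_sumr;
  under eq_bigr => j _ do rewrite IH).
under [RHS]eq_bigr => i _ do rewrite tailM pmul_suml.
rewrite (sum_triangle k (fun i j =>
  pmul (pmul (ptail i f) (ptail j g)) (ptail (k - i - j) h) e)).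
apply: eq_bigr => i _; apply: eq_bigr => j _.
by rewrite -subnDA subnKC // -ltnS.
Qed.

Lemma pmul1 f : pmul (pmonomial [::]) f = f.
Proof.
apply/funext => e; elim: e f => [|k e IH] f.
  by rewrite pmul_nil mul1r.
rewrite pmul_cons big_ord_recl /= subn0 IH big1 ?addr0 // => i _.
by rewrite /pmul big1 // => p _; rewrite /ptail /pmonomial /= mul0r.
Qed.

Lemma quasisymmetric_nonzero f :
  quasisymmetric f <-> forall e, f e = f (nonzero e).
Proof.
split=> [qf e|qf d e de]; last by rewrite qf de -qf.
by apply: qf; rewrite /nonzero filter_id.
Qed.

Lemma quasisymmetric_tail f i : quasisymmetric f -> quasisymmetric (ptail i f).
Proof. by move=> qf d e de; apply: qf; rewrite /nonzero /=; case: ifP => _; rewrite ?[filter _ _]de. Qed.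

Lemma quasisymmetric_mul f g :
  quasisymmetric f -> quasisymmetric g -> quasisymmetric (pmul f g).
Proof.
move=> qf qg; apply/quasisymmetric_nonzero => e.
elim: e f g qf qg => [//|k e IH] f g qf qg.
have tail0 u : quasisymmetric u -> ptail 0 u = u.
  by move=> qu; apply/funext => d; apply: qu.
rewrite /=; case: k => [|k] /=.
  by rewrite pmul_cons big_ord1 !tail0 // IH.
rewrite !pmul_cons; apply: eq_bigr => i _.
by apply: IH; apply: quasisymmetric_tail.
Qed.

Lemma bounded_degree_mul f g :
  bounded_degree f -> bounded_degree g -> bounded_degree (pmul f g).
Proof.
move=> [a fa] [b gb]; exists (a + b)%N => e h.
rewrite /pmul big_seq big1 // => p /sumn_splits pe.
have [/fa->|pa] := ltnP a (sumn p.1); first by rewrite mul0r.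
by rewrite gb ?mulr0 // -(ltn_add2l a) (leq_trans h) // -pe leq_add2r.
Qed.

Definition qsym_pred : {pred pseries} :=
  fun f => `[< quasisymmetric f /\ bounded_degree f >].

Lemma qsym_submod : submod_closed qsym_pred.
Proof.
split=> [|a f g]; first by apply/asboolP; split=> //; exists 0.
move=> /asboolP[qf [m fm]] /asboolP[qg [n gn]]; apply/asboolP; split.
  by move=> d e de; rewrite /GRing.add /GRing.scale /= (qf d e) // (qg d e).
exists (maxn m n) => e; rewrite gtn_max => /andP[me ne].
by rewrite /GRing.add /GRing.scale /= fm // gn // scaler0 addr0.
Qed.

HB.instance Definition _ :=
  GRing.isSubmodClosed.Build rat pseries qsym_pred qsym_submod.

Record QSym : predArgType := QSymPack { coefs :> pseries; _ : coefs \in qsym_pred }.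
HB.instance Definition _ := [isSub for coefs].
HB.instance Definition _ := [Choice of QSym by <:].
HB.instance Definition _ := [SubChoice_isSubLmodule of QSym by <:].

Lemma qsymP (f : QSym) : quasisymmetric f /\ bounded_degree f.
Proof. by case: f => f /= /asboolP. Qed.

Definition qsym (f : pseries) (qf : quasisymmetric f) (bf : bounded_degree f) :
  QSym := QSymPack (asboolT (conj qf bf)).

Lemma quasisymmetric_monomial al : quasisymmetric (pmonomial al).
Proof. by move=> d e; rewrite /pmonomial => ->. Qed.

Lemma sumn_nonzero e : sumn (nonzero e) = sumn e.
Proof. by elim: e => //= -[|k] e /= ->. Qed.

Lemma bounded_degree_monomial al : bounded_degree (pmonomial al).
Proof.
exists (sumn al) => e; rewrite -(sumn_nonzero e) /pmonomial.
by case: (nonzero e =P al) => // ->; rewrite ltnn.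
Qed.

Definition qmonomial (al : seq nat) : QSym :=
  qsym (@quasisymmetric_monomial al) (@bounded_degree_monomial al).

Definition qmul (f g : QSym) : QSym :=
  qsym (quasisymmetric_mul (qsymP f).1 (qsymP g).1)
       (bounded_degree_mul (qsymP f).2 (qsymP g).2).

Lemma qmulA : associative qmul.
Proof. by move=> f g h; apply/val_inj/pmulA. Qed.

Lemma qmulC : commutative qmul.
Proof. by move=> f g; apply/val_inj/pmulC. Qed.

Lemma qmul1 : left_id (qmonomial [::]) qmul.
Proof. by move=> f; apply/val_inj/pmul1. Qed.

Lemma qmulDl : left_distributive qmul +%R.
Proof. by move=> f g h; apply/val_inj/funext => e; apply: pmulDl. Qed.

Lemma qone_neq0 : qmonomial [::] != 0.
Proof.
apply/eqP => /(congr1 (fun f : QSym => f [::])) /eqP.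
by rewrite /qmonomial /= /pmonomial eqxx oner_eq0.
Qed.

HB.instance Definition _ := GRing.Zmodule_isComNzRing.Build QSym
  qmulA qmulC qmul1 qmulDl qone_neq0.

Lemma qsym_scalerAl (a : rat) (f g : QSym) : a *: (f * g) = a *: f * g.
Proof.
apply/val_inj/funext => e; rewrite /= /pmul.
rewrite [LHS]mulr_sumr; apply: eq_bigr => p _; exact: mulrA.
Qed.

HB.instance Definition _ := GRing.Lmodule_isLalgebra.Build rat QSym qsym_scalerAl.
HB.instance Definition _ := GRing.Lalgebra_isComAlgebra.Build rat QSym.

(* f lies in the component QSym_d. *)
Definition homogeneous (d : nat) (f : QSym) : Prop :=
  forall e, sumn e <> d -> f e = 0.

(* The direct sum of the QSym_d for d >= 1 (see qsym_mP). *)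
Definition qsym_m (f : QSym) : Prop :=
  exists n (g : 'I_n -> QSym),
    (forall i : 'I_n, homogeneous i.+1 (g i)) /\ f = \sum_i g i.

(* The square of the ideal qsym_m. *)
Definition qsym_m2 (h : QSym) : Prop :=
  exists n (f g : 'I_n -> QSym),
    [/\ forall i, qsym_m (f i), forall i, qsym_m (g i)
      & h = \sum_i f i * g i].

Lemma coef_sum n (g : 'I_n -> QSym) e : (\sum_i g i : QSym) e = \sum_i g i e.
Proof. by elim/big_rec2: _ => [//|i x y _ <-]. Qed.

Lemma coef_mul (f g : QSym) e : (f * g) e = pmul f g e.
Proof. by []. Qed.

Lemma coef1 : (1 : QSym) [::] = 1.
Proof. by []. Qed.

Lemma qsym_mP f : qsym_m f <-> f [::] = 0.
Proof.
split=> [[n [g [hg ->]]]|f0].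
  by rewrite coef_sum big1 // => i _; apply: hg.
have [qf [D bf]] := qsymP f.
pose c d : pseries := fun e => if sumn e == d then f e else 0.
have qc d : quasisymmetric (c d).
  by move=> x y xy; rewrite /c -sumn_nonzero xy sumn_nonzero (qf x y).
have bc d : bounded_degree (c d).
  by exists d => e; rewrite /c ltnNge; case: eqP => // ->; rewrite leqnn.
exists D, (fun i => qsym (qc i.+1) (bc i.+1)); split=> [i e|].
  by move/eqP/negPf=> h; rewrite /= /c h.
apply/val_inj/funext => e; rewrite [RHS]coef_sum /= /c.
have [De|eD] := ltnP D (sumn e).
  by rewrite big1 => [|i _]; rewrite ?if_same bf // if_same.
case E: (sumn e) eD => [|n] nD.
  rewrite big1 // (qf _ [::]) //.
  by elim: (e) E => //= -[|k] x /= IH // /IH.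
rewrite (bigD1 (Ordinal nD)) //= eqxx big1 ?addr0 // => i.
by rewrite -val_eqE /= eqSS eq_sym => /negPf->.
Qed.

Definition qsym_m2_pred : {pred QSym} := fun h => `[< qsym_m2 h >].

Lemma qsym_m2_closed : idealr_closed qsym_m2_pred.
Proof.
split.
- apply/asboolP; exists 0, (fun=> 0), (fun=> 0); split; last by rewrite big_ord0.
    by case.
  by case.
- apply/asboolPn => -[n [f [g [hf hg /(congr1 (fun h : QSym => h [::]))]]]].
  rewrite coef1 coef_sum big1 => [/eqP|i _]; first by rewrite oner_eq0.
  by rewrite coef_mul pmul_nil (qsym_mP (f i)).1 ?mul0r.
move=> a u v /asboolP[m [f [g [hf hg ->]]]] /asboolP[n [f' [g' [hf' hg' ->]]]].
apply/asboolP; exists (m + n)%N.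
exists (fun i => match split i with inl j => a * f j | inr j => f' j end).
exists (fun i => match split i with inl j => g j | inr j => g' j end).
split=> [i|i|].
- case: split => j //; apply/qsym_mP.
  by rewrite coef_mul pmul_nil [X in _ * X](qsym_mP (f j)).1 ?mulr0.
- by case: split.
rewrite big_split_ord /= mulr_sumr; congr (_ + _); apply: eq_bigr => i _.
  by rewrite (unsplitK (inl i)) mulrA.
by rewrite (unsplitK (inr i)).
Qed.

HB.instance Definition _ :=
  isIdealr.Build QSym qsym_m2_pred qsym_m2_closed.

Notation QSym_m2 := {ideal_quot qsym_m2_pred}.

Local Open Scope quotient_scope.

Definition qscale (a : rat) (x : QSym_m2) : QSym_m2 := \pi_QSym_m2 (a *: repr x).

Lemma pi_scale a f : \pi_QSym_m2 (a *: f) = qscale a (\pi_QSym_m2 f).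
Proof.
apply/eqP; rewrite -Quotient.idealrBE -scalerBr -mulr_algl; apply: idealMr.
by rewrite Quotient.idealrBE reprK.
Qed.

Lemma qscaleA a b x : qscale a (qscale b x) = qscale (a * b) x.
Proof. by elim/quotW: x => f; rewrite -(pi_scale b) -!pi_scale scalerA. Qed.

Lemma qscale1 : left_id 1 qscale.
Proof. by elim/quotW => f; rewrite -pi_scale scale1r. Qed.

Lemma qscaleDr : right_distributive qscale +%R.
Proof.
move=> a; elim/quotW => f; elim/quotW => g.
by rewrite -raddfD -!pi_scale -raddfD scalerDr.
Qed.

Lemma qscaleDl x : {morph qscale^~ x : a b / a + b}.
Proof.
by move=> a b; elim/quotW: x => f; rewrite -!pi_scale -raddfD scalerDl.
Qed.

HB.instance Definition _ := GRing.Zmodule_isLmodule.Build rat QSym_m2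
  qscaleA qscale1 qscaleDr qscaleDl.

HB.instance Definition _ :=
  GRing.isScalable.Build rat QSym QSym_m2 *:%R \pi_QSym_m2 pi_scale.

Definition proper_sums (al : seq nat) : seq nat :=
  [seq sumn (take i al) | i <- iota 1 (size al).-1].

(* be is finer than (or equal to) al. *)
Definition refines (be al : seq nat) : bool :=
  (sumn be == sumn al) && all (mem (proper_sums be)) (proper_sums al).

(* All the compositions of n (see mem_compositions). *)
Fixpoint compositions (n : nat) : seq (seq nat) :=
  if n is m.+1 then
    flatten [seq if al is a :: al' then [:: 1%N :: al; a.+1 :: al'] else [:: [:: 1%N]]
            | al <- compositions m]
  else [:: [::]].

Lemma mem_compositions n al :
  (al \in compositions n) = (sumn al == n) && all (leq 1) al.
Proof.
elim: n al => [|n IH] al; first by rewrite inE; case: al => [|[|a] al]; rewrite ?andbF /= ?andbF.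
have hI : (al \in compositions n.+1) =
    has (fun be => al \in (if be is b :: be' then [:: 1%N :: be; b.+1 :: be']
                         else [:: [:: 1%N]])) (compositions n).
  by rewrite /=; elim: (compositions n) => //= be s IHs; rewrite mem_cat IHs.
rewrite hI; apply/hasP/idP => [[[|b be] + +]|].
- by rewrite IH !inE /= => /andP[/eqP<- _] /eqP->.
- rewrite IH !inE /= => /andP[/eqP<- /andP[b0 be0]] /orP[]/eqP-> /=.
    by rewrite b0 be0 eqxx.
  by rewrite be0 eqxx.
case: al {hI} => [|[|[|a]] al] //= /andP[/eqP e p] //.
- case: (e : (sumn al).+1 = n.+1) => {}e; exists al; first by rewrite IH -e eqxx.
  by case: al {e p} => [|b al]; rewrite !inE eqxx.
- case: (e : (a.+1 + sumn al).+1 = n.+1) => {}e; exists (a.+1 :: al); first by rewrite IH /= -e p addSn eqxx.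
  by rewrite !inE eqxx orbT.
Qed.

Definition qfundamental (al : seq nat) : QSym :=
  \sum_(be <- compositions (sumn al) | refines be al) qmonomial be.

(* Lengths of the maximal increasing runs, when x is the k-th entry of the run in
   progress and s is what follows x. *)
Fixpoint runs_from (x k : nat) (s : seq nat) : seq nat :=
  if s is y :: s' then
    if (x < y)%N then runs_from y k.+1 s' else k :: runs_from y 1 s'
  else [:: k].

Definition run_lengths (s : seq nat) : seq nat :=
  if s is x :: s' then runs_from x 1 s' else [::].

(* A labeled poset is given as its strict order lt on a finite type E together
   with the label lab x of each element x. *)
Section LabeledPoset.
Variables (E : finType) (lt : rel E) (lab : E -> nat).

Definition linear_extension (s : seq E) : bool :=
  perm_eq s (enum E) &&
  [forall x, forall y, lt x y ==> (index x s < index y s)%N].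

Definition F_poset : QSym :=
  \sum_(s : #|E|.-tuple E | linear_extension s)
    qfundamental (run_lengths (map lab s)).

Definition strict_labeling : Prop :=
  [/\ injective lab, forall x, (0 < lab x)%N
    & forall x y, lt x y -> (lab y < lab x)%N].

End LabeledPoset.

Lemma eq_mem_set (T : finType) (Bs : {set {set T}}) (A B : {set T}) :
  A =i B -> (A \in Bs) = (B \in Bs).
Proof. by move/setP=> ->. Qed.

Lemma mem_set_eq (T : finType) (Bs : {set {set T}}) (A B : {set T}) :
  A \in Bs -> A =i B -> B \in Bs.
Proof. by move=> + /setP <-. Qed.

Definition is_bases (E : finType) (Bs : {set {set E}}) : bool :=
  (Bs != set0) &&
  [forall B1 in Bs, forall B2 in Bs, forall x in B1 :\: B2,
     exists y in B2 :\: B1, (y |: (B1 :\ x)) \in Bs].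

Record matroid (E : finType) : predArgType :=
  Matroid { bases : {set {set E}}; _ : is_bases bases }.
HB.instance Definition _ E := [isSub for @bases E].
HB.instance Definition _ E := [Finite of matroid E by <:].

Lemma is_basesP (E : finType) (Bs : {set {set E}}) :
  reflect (Bs != set0 /\ forall B1 B2, B1 \in Bs -> B2 \in Bs ->
             forall x, x \in B1 :\: B2 ->
             exists2 y, y \in B2 :\: B1 & (y |: (B1 :\ x)) \in Bs)
          (is_bases Bs).
Proof.
apply: (iffP andP) => -[-> h]; split=> //.
  move=> B1 B2 h1 h2 x hx.
  by move: h => /forall_inP/(_ _ h1)/forall_inP/(_ _ h2)/forall_inP/(_ _ hx)/exists_inP.
apply/forall_inP => B1 h1; apply/forall_inP => B2 h2; apply/forall_inP => x hx.
by apply/exists_inP/h.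
Qed.

Definition rank (E : finType) (M : matroid E) : nat :=
  \max_(B in bases M) #|B|.

Section FMatroid.
Variables (E : finType) (M : matroid E).

(* The order of P_B; transitivity is vacuous, as only elements of B are below
   something and only elements outside B are above something. *)
Definition base_lt (B : {set E}) : rel E := fun e e' =>
  [&& e \in B, e' \notin B & (e' |: (B :\ e)) \in bases M].

(* One strict labeling of P_B (see base_label_strict): every element of B gets a
   larger label than every element outside B. *)
Definition base_label (B : {set E}) (e : E) : nat :=
  (if e \in B then #|E| + enum_rank e else enum_rank e).+1.

Lemma base_label_strict B : strict_labeling (base_lt B) (base_label B).
Proof.
have lt_rank (x y : E) : (enum_rank x < #|E| + enum_rank y)%N.
  exact: ltn_addr.
split=> [x y||x y] //; rewrite /base_label.
  case: ifP => _; case: ifP => _ [].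
  - by move/addnI/val_inj/enum_rank_inj.
  - by move=> e; have := lt_rank y x; rewrite -e ltnn.
  - by move=> e; have := lt_rank x y; rewrite e ltnn.
  - by move/val_inj/enum_rank_inj.
by case/and3P=> -> /negPf-> _; rewrite ltnS.
Qed.

Definition F_matroid : QSym :=
  \sum_(B in bases M) F_poset (base_lt B) (base_label B).

End FMatroid.

Definition matroid_iso (E1 E2 : finType) (M1 : matroid E1) (M2 : matroid E2) :=
  exists2 f : E1 -> E2, bijective f &
    forall B : {set E2}, (B \in bases M2) = (f @^-1: B \in bases M1).

Lemma iso_refl (E : finType) (M : matroid E) : matroid_iso M M.
Proof.
exists id => [|B]; first by exists id.
by apply: eq_mem_set => x; rewrite inE.
Qed.

Lemma iso_sym (E1 E2 : finType) (M1 : matroid E1) (M2 : matroid E2) :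
  matroid_iso M1 M2 -> matroid_iso M2 M1.
Proof.
case=> f [g fK gK] h; exists g; first by exists f.
by move=> B; rewrite h; apply: eq_mem_set => x; rewrite !inE fK.
Qed.

Lemma iso_trans (E1 E2 E3 : finType)
    (M1 : matroid E1) (M2 : matroid E2) (M3 : matroid E3) :
  matroid_iso M1 M2 -> matroid_iso M2 M3 -> matroid_iso M1 M3.
Proof.
case=> f bf hf [g bg hg]; exists (g \o f); first exact: bij_comp.
by move=> B; rewrite hg hf; apply: eq_mem_set => x; rewrite !inE.
Qed.

Section DirectSum.
Variables (E1 E2 : finType) (M1 : matroid E1) (M2 : matroid E2).

Definition dsum_bases : {set {set (E1 + E2)%type}} :=
  [set B : {set E1 + E2} | (inl @^-1: B \in bases M1) && (inr @^-1: B \in bases M2)].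

Lemma dsum_subproof : is_bases dsum_bases.
Proof.
have /is_basesP[/set0Pn[C1 hC1] ex1] := valP M1.
have /is_basesP[/set0Pn[C2 hC2] ex2] := valP M2.
apply/is_basesP; split.
  apply/set0Pn; exists [set s | match s with inl x => x \in C1 | inr y => y \in C2 end].
  rewrite inE; apply/andP; split;
    [apply: (mem_set_eq hC1)|apply: (mem_set_eq hC2)] => x; by rewrite !inE.
move=> B1 B2; rewrite !inE => /andP[l1 r1] /andP[l2 r2] [x|x]; rewrite !inE => hx.
  have [|y] := ex1 _ _ l1 l2 x; rewrite !inE // => hy hB.
  exists (inl y); rewrite !inE //; apply/andP; split; 
    [apply: (mem_set_eq hB)|apply: (mem_set_eq r1)] => z; by rewrite !inE.
have [|y] := ex2 _ _ r1 r2 x; rewrite !inE // => hy hB.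
exists (inr y); rewrite !inE //; apply/andP; split; 
    [apply: (mem_set_eq l1)|apply: (mem_set_eq hB)] => z; by rewrite !inE.
Qed.

Definition dsum : matroid (E1 + E2)%type := Matroid dsum_subproof.

End DirectSum.

Lemma dsum_iso (E1 E2 E1' E2' : finType) (M1 : matroid E1) (M2 : matroid E2)
    (M1' : matroid E1') (M2' : matroid E2') :
  matroid_iso M1 M1' -> matroid_iso M2 M2' ->
  matroid_iso (dsum M1 M2) (dsum M1' M2').
Proof.
case=> f [f' fK f'K] hf [g [g' gK g'K] hg].
exists (fun s => match s with inl x => inl (f x) | inr y => inr (g y) end).
  exists (fun s => match s with inl x => inl (f' x) | inr y => inr (g' y) end);
  by case=> x; rewrite ?fK ?gK ?f'K ?g'K.
move=> B; rewrite !inE hf hg.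
by congr andb; apply: eq_mem_set => x; rewrite !inE.
Qed.

Lemma dsumC_iso (E1 E2 : finType) (M1 : matroid E1) (M2 : matroid E2) :
  matroid_iso (dsum M1 M2) (dsum M2 M1).
Proof.
exists (fun s => match s with inl x => inr x | inr y => inl y end).
  exists (fun s => match s with inl x => inr x | inr y => inl y end); by case.
move=> B; rewrite !inE andbC.
by congr andb; apply: eq_mem_set => x; rewrite !inE.
Qed.

Lemma dsumA_iso (E1 E2 E3 : finType)
    (M1 : matroid E1) (M2 : matroid E2) (M3 : matroid E3) :
  matroid_iso (dsum M1 (dsum M2 M3)) (dsum (dsum M1 M2) M3).
Proof.
exists (fun s => match s with inl x => inl (inl x) | inr (inl y) => inl (inr y)
                            | inr (inr z) => inr z end).
  exists (fun s => match s with inl (inl x) => inl x | inl (inr y) => inr (inl y)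
                              | inr z => inr (inr z) end); by repeat case.
move=> B; rewrite !inE andbA.
by congr (_ && _ && _); apply: eq_mem_set => x; rewrite !inE.
Qed.

Lemma empty_subproof : is_bases [set set0 : {set void}].
Proof.
apply/is_basesP; split=> [|B1 B2]; last by move=> _ _ [].
by apply/set0Pn; exists set0; rewrite inE.
Qed.

Definition empty_matroid : matroid void := Matroid empty_subproof.

Lemma dsum_empty_iso (E : finType) (M : matroid E) :
  matroid_iso (dsum empty_matroid M) M.
Proof.
apply: iso_sym; exists inr; first by exists (fun s => match s with inl v => of_void E v | inr x => x end) => // -[[]|].
move=> B; rewrite !inE [X in X && _](_ : _ = true) //.
by apply/eqP/setP => -[].
Qed.

(* Indecomposable for the direct sum; the empty matroid, which is the unit for
   the direct sum, is not connected. *)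
Definition connected (E : finType) (M : matroid E) : Prop :=
  (0 < #|E|)%N /\
  forall (E1 E2 : finType) (M1 : matroid E1) (M2 : matroid E2),
    matroid_iso M (dsum M1 M2) -> #|E1| = 0%N \/ #|E2| = 0%N.

(* Every finite matroid is isomorphic to one on some 'I_n, so mclass is the set of
   isomorphism classes of finite matroids (see class_of and class_ofP). *)
Definition omatroid : Type := {n : nat & matroid 'I_n}.
HB.instance Definition _ := Choice.on omatroid.

Definition omatroid_iso (x y : omatroid) : bool :=
  `[< matroid_iso (projT2 x) (projT2 y) >].

Lemma omatroid_iso_equiv : equiv_class_of omatroid_iso.
Proof.
split=> [x|x y|y x z]; first by apply/asboolP/iso_refl.
  by apply/asboolP/asboolP => /iso_sym.
by move=> /asboolP xy /asboolP yz; apply/asboolP/(iso_trans xy).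
Qed.
Canonical omatroid_equiv := EquivRelPack omatroid_iso_equiv.

Definition mclass : Type := {eq_quot omatroid_iso}.
HB.instance Definition _ := Choice.on mclass.
HB.instance Definition _ := EqQuotient.on mclass.

Definition rep (c : mclass) : matroid 'I_(projT1 (repr c)) := projT2 (repr c).

Section ClassOf.
Variables (E : finType) (M : matroid E).

Definition relabel_bases : {set {set 'I_#|E|}} :=
  [set B : {set 'I_#|E|} | enum_rank @^-1: B \in bases M].

Lemma relabel_subproof : is_bases relabel_bases.
Proof.
have /is_basesP[/set0Pn[C hC] ex] := valP M.
apply/is_basesP; split.
  apply/set0Pn; exists (enum_val @^-1: C); rewrite inE.
  by apply: (mem_set_eq hC) => x; rewrite !inE enum_rankK.
move=> B1 B2; rewrite !inE => h1 h2 x; rewrite !inE => hx.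
have [|y] := ex _ _ h1 h2 (enum_val x); rewrite !inE ?enum_valK // => hy hB.
exists (enum_rank y); rewrite !inE //; apply: (mem_set_eq hB) => z; rewrite !inE (inj_eq enum_rank_inj).
by rewrite (can2_eq enum_rankK enum_valK).
Qed.

Definition relabel : matroid 'I_#|E| := Matroid relabel_subproof.

Lemma relabel_iso : matroid_iso M relabel.
Proof.
exists enum_rank => [|B]; last by rewrite inE.
by exists enum_val; [apply: enum_rankK | apply: enum_valK].
Qed.

Definition class_of : mclass := \pi_mclass (existT _ #|E| relabel).

Lemma rep_class_of : matroid_iso M (rep class_of).
Proof.
apply: iso_trans relabel_iso _; rewrite /rep /class_of.
set x := existT _ _ _; have : x = repr (\pi_mclass x) %[mod mclass] by rewrite reprK.
by move/eqmodP/asboolP.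
Qed.

End ClassOf.

Lemma class_ofP (E1 E2 : finType) (M1 : matroid E1) (M2 : matroid E2) :
  matroid_iso M1 M2 <-> class_of M1 = class_of M2.
Proof.
split=> [h|e].
  apply/eqmodP/asboolP/(iso_trans (iso_sym (relabel_iso M1)))/(iso_trans h).
  exact: relabel_iso.
apply: iso_trans (rep_class_of M1) _; rewrite e.
exact/iso_sym/rep_class_of.
Qed.

Lemma class_of_rep c : class_of (rep c) = c.
Proof.
rewrite -[RHS]reprK; apply/eqmodP/asboolP/iso_sym.
exact: relabel_iso.
Qed.

Definition mclass_one : mclass := class_of empty_matroid.
Definition mclass_mul (c d : mclass) : mclass := class_of (dsum (rep c) (rep d)).

Lemma mclass_mulE (E1 E2 : finType) (M1 : matroid E1) (M2 : matroid E2) :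
  mclass_mul (class_of M1) (class_of M2) = class_of (dsum M1 M2).
Proof.
by apply/class_ofP/dsum_iso; apply/iso_sym/rep_class_of.
Qed.

Lemma mclass_mulC : commutative mclass_mul.
Proof. by move=> c d; apply/class_ofP/dsumC_iso. Qed.

Lemma mclass_mulA : associative mclass_mul.
Proof.
move=> b c d; rewrite -[b]class_of_rep -[c]class_of_rep -[d]class_of_rep.
by rewrite !mclass_mulE; apply/class_ofP/dsumA_iso.
Qed.

Lemma mclass_mul1 : left_id mclass_one mclass_mul.
Proof.
move=> c; rewrite -[c]class_of_rep mclass_mulE.
exact/class_ofP/dsum_empty_iso.
Qed.

Lemma mclass_mulr1 : right_id mclass_one mclass_mul.
Proof. by move=> c; rewrite mclass_mulC mclass_mul1. Qed.

Lemma iso_card (E1 E2 : finType) (M1 : matroid E1) (M2 : matroid E2) :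
  matroid_iso M1 M2 -> #|E1| = #|E2|.
Proof. by case=> f /bij_eq_card. Qed.

Lemma mclass_one_card (E : finType) (M : matroid E) :
  #|E| = 0%N -> class_of M = mclass_one.
Proof.
move=> E0; have noE : E -> False by move=> x; have := fintype0 x E0.
have sub1 (B C : {set E}) : B = C by apply/setP => x; case: (noE x).
apply/class_ofP; exists (fun x => match noE x with end).
  by exists (of_void E) => [x|[]]; case: (noE x).
move=> B; have -> : B = set0 by apply/setP => -[].
have /is_basesP[/set0Pn[C hC] _] := valP M.
by rewrite inE eqxx (sub1 (_ @^-1: _) C) hC.
Qed.

Lemma mclass_mul_eq1 c d :
  mclass_mul c d = mclass_one -> c = mclass_one /\ d = mclass_one.
Proof.
move=> /class_ofP/iso_card; rewrite card_sum card_void => /eqP.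
rewrite addn_eq0 => /andP[/eqP c0 /eqP d0].
by rewrite -(class_of_rep c) -(class_of_rep d) !mclass_one_card.
Qed.

HB.instance Definition _ := Choice_isMonomialDef.Build mclass
  mclass_mulA mclass_mul1 mclass_mulr1 mclass_mul_eq1.
HB.instance Definition _ := MonomialDef_isConomialDef.Build mclass mclass_mulC.

(* The monoid algebra of mclass under direct sum, in which << c >> is the basis
   element of the class c. *)
Notation Mat := {malg rat[mclass]}.

(* The linear extension of [M] |-> F(M). *)
Definition F_Mat (x : Mat) : QSym :=
  \sum_(c <- msupp x) x@_c *: F_matroid (rep c).

Lemma F_Mat_class c : F_Mat << c >> = F_matroid (rep c).
Proof. by rewrite /F_Mat msuppU oner_eq0 big_seq_fset1 mcoeffUU scale1r. Qed.

Lemma F_Mat_linear : linear F_Mat.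
Proof.
have FE x : F_Mat x = mmap (in_alg QSym) (fun c => F_matroid (rep c)) x.
  by apply: eq_bigr => c _; rewrite mulr_algl.
move=> a x y; rewrite !FE raddfD /=; congr (_ + _).
rewrite (mmapEw (msuppZ_le _ _)) mmapE scaler_sumr; apply: eq_bigr => c _.
by rewrite mcoeffZ !mulr_algl scalerA.
Qed.

HB.instance Definition _ :=
  GRing.isLinear.Build rat Mat QSym *:%R F_Mat F_Mat_linear.

(* The span of the classes of connected matroids. *)
Definition Mat_c_pred : {pred Mat} :=
  fun x => `[< forall c, c \in msupp x -> connected (rep c) >].

Lemma Mat_c_submod : submod_closed Mat_c_pred.
Proof.
split=> [|a x y /asboolP hx /asboolP hy]; apply/asboolP => c.
  by rewrite msupp0.
move/(fsubsetP (msuppD_le _ _)); rewrite in_fsetU => /orP[|/hy//].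
by move/(fsubsetP (msuppZ_le _ _))/hx.
Qed.

HB.instance Definition _ :=
  GRing.isSubmodClosed.Build rat Mat Mat_c_pred Mat_c_submod.

Record Mat_c : predArgType :=
  MatC { Mat_c_val :> Mat; _ : Mat_c_val \in Mat_c_pred }.
HB.instance Definition _ := [isSub for Mat_c_val].
HB.instance Definition _ := [Choice of Mat_c by <:].
HB.instance Definition _ := [SubChoice_isSubLmodule of Mat_c by <:].

Definition Fbar : Mat_c -> QSym_m2 := \pi_QSym_m2 \o F_Mat \o \val.

HB.instance Definition _ :=
  GRing.Linear.copy Fbar (\pi_QSym_m2 \o F_Mat \o \val).

Definition rank2_classes : set Mat :=
  [set << c >> | c in [set c | rank (rep c) = 2%N]]%classic.

Definition connected_rank2_classes : set Mat_c :=
  [set x | exists c : mclass,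
     [/\ connected (rep c), rank (rep c) = 2%N & \val x = << c >>]]%classic.

(* Main.v *)
Require Import Defs.
From mathcomp Require Import all_boot all_order all_algebra.
From mathcomp Require Import classical_sets.
From mathcomp Require Import boolp.
From mathcomp Require Import fintype finset zify.

(* A rank two matroid M is a complete multipartite graph (x and y are adjacent
   when {x, y} is a basis, the parts being the parallel classes) together with
   isolated vertices, the loops.  Its isomorphism class is determined by how many
   vertices there are of each degree.

   The coefficients of F(P), for P strictly labeled, count the strict maps from P
   to a chain with fibers of prescribed sizes.  In F(M) the largest possible first
   exponent is the number of loops plus 2; the coefficients with that first
   exponent give the number of nonloops, and those with the exponent one less give
   a system for the degree counts that is triangular.

   Modulo the square of m, let T_k f be the coefficient of the k-th power of the
   first variable in f, as a series in the others.  Newton's identities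
   d T_d = T_0 P_d + T_1 P_(d-1) + ... + T_(d-1) P_1 define derivations P_d of
   QSym (T_0 is the identity on QSym), so the constant term of [P_c, P_d] f
   vanishes for f in m^2.  For M loopless of rank two on n = c + d elements, its
   value at F(M) is, up to sign, d b_d - c b_c, with b_k the number of vertices of
   degree k.  If M is connected, adjacent vertices have degrees of sum more than n,
   so b_c b_d = 0 for c <> d, and these values determine all the b_k. *)

Set Implicit Arguments.
Unset Strict Implicit.
Unset Printing Implicit Defensive.

Import GRing.Theory.
Local Open Scope nat_scope.

(** * Coefficients of F of a strictly labeled poset *)

Section StrictPosets.
Variables (E : finType) (lt : rel E).
Implicit Types (R A : {set E}) (e : seq nat) (s : seq E).

(** Such an [A] consists of minimal elements of [R], so it is both an antichain and an order ideal,
    as the lowest fiber of a strict map must be. *)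
Definition antichain_ideal R A :=
  (A \subset R) && [forall x in R, forall y in A, ~~ lt x y].

(* The number of maps f from R to a chain, with f x < f y whenever lt x y and with
   fibers of sizes e; A is the fiber of the smallest value. *)
Fixpoint count_maps R e : nat :=
  if e is k :: e' then
    \sum_(A : {set E} | (#|A| == k) && antichain_ideal R A) count_maps (R :\: A) e'
  else R == set0.

Variable lab : E -> nat.
Hypothesis lab_inj : injective lab.
Hypothesis lab_lt : forall x y, lt x y -> lab y < lab x.

Definition sorted_by_label A := sort (relpre lab leq) (enum A).

(** Writing the fibers of a strict map one after the other, each by increasing label, turns the maps
    of [count_maps] into words. *)
Fixpoint block_words R e : seq (seq E) :=
  if e is k :: e' then
    [seq sorted_by_label A ++ w |
       A <- enum [set A : {set E} | (#|A| == k) && antichain_ideal R A],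
       w <- block_words (R :\: A) e']
  else if R == set0 then [:: [::]] else [::].

Fixpoint block_increasing e (w : seq nat) : bool :=
  if e is k :: e' then
    [&& k <= size w, sorted ltn (take k w) & block_increasing e' (drop k w)]
  else w == [::].

Definition compatible R s :=
  [forall x in R, forall y in R, lt x y ==> (index x s < index y s)].

Lemma size_block_words R e : size (block_words R e) = count_maps R e.
Proof.
elim: e R => [|k e IH] R /=; first by case: eqP.
rewrite size_allpairs_dep sumnE big_map big_enum /=.
by apply: eq_big => [A|A _]; rewrite ?inE ?IH.
Qed.

Lemma mem_sorted_by_label A : sorted_by_label A =i A.
Proof. by move=> x; rewrite mem_sort mem_enum. Qed.

Lemma size_sorted_by_label A : size (sorted_by_label A) = #|A|.
Proof. by rewrite size_sort -cardE. Qed.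

Lemma block_words_uniq R e : uniq (block_words R e).
Proof.
elim: e R => [|k e IH] R /=; first by case: eqP.
apply: allpairs_uniq_dep => [|A _|]; rewrite ?enum_uniq ?IH //.
move=> _ _ /allpairsPdep[A [w [+ hw ->]]] /allpairsPdep[A' [w' [+ hw' ->]]] /=.
rewrite !mem_enum !inE => /andP[/eqP kA _] /andP[/eqP kA' _] /eqP.
rewrite eqseq_cat ?size_sorted_by_label ?kA ?kA' // => /andP[/eqP eA /eqP ew].
have AA : A = A' by apply/setP => x; rewrite -!mem_sorted_by_label eA.
by rewrite AA ew.
Qed.

Lemma sorted_by_label_sorted A : sorted ltn (map lab (sorted_by_label A)).
Proof.
rewrite ltn_sorted_uniq_leq map_inj_uniq // sort_uniq enum_uniq /= sorted_map.
by apply: sort_sorted => x y; apply: leq_total.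
Qed.

Lemma sorted_by_labelE s : sorted ltn (map lab s) ->
  s = sorted_by_label [set x in s].
Proof.
move=> hs; apply: (@irr_sorted_eq _ (relpre lab ltn)).
- by move=> y x z; apply: ltn_trans.
- by move=> x; apply: ltnn.
- by rewrite -sorted_map.
- by rewrite -sorted_map sorted_by_label_sorted.
by move=> x; rewrite mem_sorted_by_label inE.
Qed.

Lemma sorted_index s x y : sorted ltn (map lab s) -> x \in s -> y \in s ->
  lab x < lab y -> index x s < index y s.
Proof.
move=> hs xs ys; rewrite ltnNge => /negP h; rewrite ltnNge; apply/negP => hi.
apply: h; move: hi; rewrite leq_eqVlt => /orP[/eqP hi|hi].
  by rewrite -(nth_index x ys) hi nth_index.
have [hx hy] : index x s < size s /\ index y s < size s by rewrite !index_mem.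
have := sorted_ltn_nth ltn_trans 0 hs.
move/(_ (index y s) (index x s)); rewrite !inE size_map => /(_ hy hx hi).
by rewrite !(nth_map x) // !nth_index // => /ltnW.
Qed.

(** Labels decrease along [lt]: if x < y lay in one label-increasing block, y would precede x,
    against compatibility. Hence the first block of a compatible word is made of minimal elements,
    and induction treats the rest. *)
Lemma mem_block_words R e s :
  (s \in block_words R e) =
  [&& perm_eq s (enum R), compatible R s & block_increasing e (map lab s)].
Proof.
have sizeR A s' : perm_eq s' (enum A) -> size s' = #|A|.
  by move/perm_size; rewrite cardE.
elim: e R s => [|k e IH] R s.
  rewrite /=; case: eqP => [->|/eqP R0].
    rewrite enum_set0 inE; case: s => [|x s] /=; last by rewrite !andbF.
    by rewrite eqxx andbT; apply/esym; apply/forall_inP => x; rewrite inE.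
  rewrite in_nil; case: s => [|x s]; last by rewrite !andbF.
  apply/esym/negP => /and3P[/sizeR /esym/eqP]; rewrite cards_eq0.
  by rewrite (negPf R0).
apply/allpairsPdep/and3P => [[A [w [+ + ->]]]|[pR cR]].
  rewrite mem_enum inE IH => /andP[/eqP kA /andP[AR idA]] /and3P[pw cw bw].
  have mw x : x \in w = (x \in R) && (x \notin A).
    by rewrite (perm_mem pw) mem_enum !inE andbC.
  split.
  - apply: uniq_perm; last 1 first.
    + move=> x; rewrite mem_cat mem_sorted_by_label mem_enum mw.
      by have /subsetP/(_ x) := AR; case: (x \in A) => [->|] //=; rewrite ?andbT.
    + rewrite cat_uniq sort_uniq enum_uniq (perm_uniq pw) enum_uniq andbT /=.
      by apply/hasPn => x; rewrite mw mem_sorted_by_label => /andP[].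
    exact: enum_uniq.
  - apply/forall_inP => x xR; apply/forall_inP => y yR; apply/implyP => xy.
    have yA : y \notin A.
      apply/negP => yA; move/forall_inP/(_ _ xR)/forall_inP/(_ _ yA): idA.
      by rewrite xy.
    rewrite !index_cat !mem_sorted_by_label (negPf yA).
    have [xA|xA] := boolP (x \in A).
      by apply: ltn_addr; rewrite index_mem mem_sorted_by_label.
    rewrite ltn_add2l; move/forall_inP/(_ x): cw; rewrite inE xA xR => /(_ isT).
    by move/forall_inP/(_ y); rewrite inE yA yR => /(_ isT)/implyP/(_ xy).
  - rewrite map_cat /= size_cat !size_map size_sorted_by_label kA leq_addr /=.
    have sk : size (map lab (sorted_by_label A)) = k.
      by rewrite size_map size_sorted_by_label.
    by rewrite -{1}sk take_size_cat // sorted_by_label_sorted drop_size_cat.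
rewrite /= size_map -map_take -map_drop => /and3P[ks sk bs].
set A := [set x in take k s].
have us : uniq s by rewrite (perm_uniq pR) enum_uniq.
have mR x : x \in R = (x \in s) by rewrite (perm_mem pR) mem_enum.
have mcat x : (x \in s) = (x \in take k s) || (x \in drop k s).
  by rewrite -mem_cat cat_take_drop.
have dis x : x \in drop k s -> x \notin take k s.
  move: us; rewrite -{1}(cat_take_drop k s) cat_uniq => /and3P[_ /hasPn h _].
  exact: h.
have tA : take k s = sorted_by_label A by apply: sorted_by_labelE.
have mD x : (x \in R :\: A) = (x \in drop k s).
  rewrite in_setD inE mR mcat; have := dis x.
  by case: (x \in drop k s) => [/(_ isT)->|_] //=; rewrite ?orbF ?andNb ?orbT.
exists A, (drop k s); split; last by rewrite -tA cat_take_drop.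
  rewrite mem_enum inE; apply/andP; split.
    by rewrite -size_sorted_by_label -tA size_takel.
  apply/andP; split.
    by apply/subsetP => x; rewrite inE mR mcat => ->.
  apply/forall_inP => x xR; apply/forall_inP => y; rewrite inE => yA.
  apply/negP => xy; have yR : y \in R by rewrite mR mcat yA.
  move/forall_inP/(_ _ xR)/forall_inP/(_ _ yR)/implyP/(_ xy): cR.
  rewrite -(cat_take_drop k s) !index_cat yA; case: ifP => xA.
    apply/negP; rewrite -leqNgt; apply/ltnW/sorted_index => //.
    exact: lab_lt.
  apply/negP; rewrite -leqNgt; apply: leq_trans (leq_addr _ _).
  by apply: ltnW; rewrite index_mem.
rewrite IH; apply/and3P; split=> //.
  apply: uniq_perm; rewrite ?enum_uniq ?drop_uniq // => x.
  by rewrite mem_enum mD.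
apply/forall_inP => x xD; apply/forall_inP => y yD; apply/implyP => xy.
have [xR yR] : x \in R /\ y \in R.
  by move: xD yD; rewrite !inE => /andP[_ ->] /andP[_ ->].
move/forall_inP/(_ _ xR)/forall_inP/(_ _ yR)/implyP/(_ xy): cR.
rewrite -{1 2}(cat_take_drop k s) !index_cat; rewrite !mD in xD yD.
by rewrite (negPf (dis _ xD)) (negPf (dis _ yD)) ltn_add2l.
Qed.

End StrictPosets.

(** * Partial sums, increasing runs and descents *)

Lemma mem_proper_sums_cons k be i :
  (i \in proper_sums (k :: be)) =
  (be != [::]) && ((i == k) || (k <= i) && (i - k \in proper_sums be)).
Proof.
case: be => [|b be]; first by rewrite /proper_sums.
have -> : proper_sums [:: k, b & be] =
    k :: [seq k + x | x <- proper_sums (b :: be)].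
  rewrite /proper_sums /= addn0; congr (_ :: _).
  rewrite -map_comp (iotaDl 1 1) -map_comp.
  by apply/eq_in_map => j; rewrite mem_iota => /andP[].
rewrite inE /=; congr orb; apply/mapP/andP => [[x hx ->]|[ki hi]].
  by rewrite leq_addr addKn.
by exists (i - k); rewrite ?subnKC.
Qed.

Lemma nonzero_eq_nil e : (nonzero e == [::]) = (sumn e == 0).
Proof. by elim: e => [|[|k] e IH]. Qed.

Lemma block_increasingP e w :
  reflect (sumn e = size w /\ forall i, i.+1 < size w ->
             (nth 0 w i < nth 0 w i.+1) || (i.+1 \in proper_sums (nonzero e)))
          (block_increasing e w).
Proof.
elim: e w => [|k e IH] w /=.
  by apply: (iffP eqP) => [->//|[/esym/size0nil]].
case: k => [|k].
  by rewrite take0 drop0 /=; apply: IH.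
rewrite ltn0Sn.
apply: (iffP and3P) => [[kw sk /IH[ew dw]]|[ew dw]].
  have sw : sumn e = size w - k.+1 by rewrite ew size_drop.
  split=> [|i iw]; first by rewrite sw subnKC.
  rewrite mem_proper_sums_cons nonzero_eq_nil.
  have [ik|ki] := ltnP i.+1 k.+1.
    have /sortedP := sk => /(_ 0 i); rewrite size_takel // !nth_take //.
      by move=> /(_ ik) /= ->.
    exact: ltnW.
  have e0 : sumn e != 0 by rewrite sw subn_eq0 -ltnNge (leq_ltn_trans ki).
  rewrite e0 /=; move: ki; rewrite leq_eqVlt => /orP[/eqP<-|ki].
    by rewrite eqxx orbT.
  have := dw (i - k.+1).
  rewrite size_drop -subSn ?ltn_sub2r ?(ltn_trans ki) // => /(_ isT).
  have ik : k < i by [].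
  rewrite !nth_drop !subnKC //; last exact: ltnW.
  by case/orP=> ->; rewrite ?orbT.
have kw : k.+1 <= size w by rewrite -ew leq_addr.
split=> //.
  apply/(sortedP 0) => i; rewrite size_takel // => ik.
  rewrite !nth_take ?(ltnW ik) //.
  have := dw i (leq_trans ik kw); rewrite mem_proper_sums_cons ltn_eqF //=.
  by rewrite [k < i.+1]leqNgt ik /= andbF orbF.
apply/IH; rewrite size_drop -ew addKn; split=> // i iw.
rewrite !nth_drop; have := dw (k.+1 + i).
rewrite -ew -addnS ltn_add2l => /(_ iw).
have -> : (k.+1 + i.+1 \in proper_sums (k.+1 :: nonzero e)) =
    (nonzero e != [::]) && (i.+1 \in proper_sums (nonzero e)).
  by rewrite mem_proper_sums_cons addKn leq_addr -[X in _ == X :> nat]addn0 eqn_add2l.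
by case/orP=> [->//|/andP[_ ->]]; rewrite orbT.
Qed.

Lemma sumn_runs_from x k s : sumn (runs_from x k s) = k + size s.
Proof.
elim: s x k => [|y s IH] x k //=; case: ifP => _ /=; rewrite ?IH //.
by rewrite addSnnS.
Qed.

Lemma runs_from_neq_nil x k s : runs_from x k s != [::].
Proof. by elim: s x k => [|y s IH] x k //=; case: ifP. Qed.

(** Runs are cut exactly where the word fails to increase; positions are shifted by [k] because [x]
    is already the [k]-th entry of the current run. *)
Lemma mem_proper_sums_runs_from x k s i :
  (i \in proper_sums (runs_from x k s)) =
  [&& k <= i, i < k + size s & ~~ (nth 0 (x :: s) (i - k) < nth 0 s (i - k))].
Proof.
elim: s x k i => [|y s IH] x k i /=.
  by rewrite addn0 /proper_sums /= in_nil; case: leqP => //= /leq_trans->.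
case: ifP => xy.
  rewrite IH addSnnS; have [<-|ne] := eqVneq k i.
    by rewrite ltnn subnn /= xy !andbF.
  rewrite [k <= i]leq_eqVlt (negPf ne) /=; case: ltnP => //= ki.
  by rewrite -!(subnSK ki).
rewrite mem_proper_sums_cons runs_from_neq_nil IH /=.
have [<-|ne] := eqVneq i k.
  by rewrite subnn /= leqnn xy -addSnnS leq_addr.
rewrite [k <= i]leq_eqVlt eq_sym (negPf ne) /=; case: ltnP => //= ki.
rewrite -!(subnSK ki) /= subn1 /= add1n ltnS -(ltn_add2l k.+1).
by rewrite subnKC // addSnnS.
Qed.

(** Both sides say that the sizes agree and that every descent of [w] is a partial sum of [e]. This
    links the fundamental basis to strict maps. *)
Lemma refines_run_lengths e w :
  refines (nonzero e) (run_lengths w) = block_increasing e w.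
Proof.
have szw : sumn (run_lengths w) = size w.
  by case: w => //= x w; rewrite sumn_runs_from.
rewrite /refines sumn_nonzero szw; apply/andP/block_increasingP.
  case=> /eqP ew /allP dw; split=> // i iw; rewrite -implyNb; apply/implyP => hi.
  apply: dw; case: w iw hi {ew szw} => //= x w iw hi.
  by rewrite mem_proper_sums_runs_from subn1 /= add1n iw.
case=> -> dw; split=> //; apply/allP => i; case: w dw {szw} => //= x w dw.
rewrite mem_proper_sums_runs_from; case: i => //= i.
rewrite subn1 /= add1n => /andP[iw]; have := dw i iw.
by case/orP=> [->|].
Qed.

(** * Coefficients of fundamental functions and of F(P) *)

Section QSymCoefficients.
Local Open Scope ring_scope.

Lemma coef_big (I : Type) (r : seq I) (P : pred I) (f : I -> QSym) e :
  (\sum_(i <- r | P i) f i) e = \sum_(i <- r | P i) f i e.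
Proof. by elim/big_rec2: _ => [//|i x y _ <-]. Qed.

Lemma compositions_uniq n : uniq (compositions n).
Proof.
elim: n => //= n IH.
set g := fun al : seq nat => _.
have -> : flatten [seq g al | al <- compositions n] =
    [seq be | al <- compositions n, be <- g al].
  by congr flatten; apply: eq_map => al; rewrite map_id.
apply: allpairs_uniq_dep => // [[|b al] hal|] //.
  rewrite /= andbT inE; apply/negP => /eqP[b0 _]; move: hal.
  by rewrite mem_compositions -b0 andbF.
(* [pre] undoes one step of the generation: it drops a leading 1 or lowers the leading part by
   one. *)
pose pre be := if be is b.+2 :: be' then b.+1 :: be' else behead be.
have preK al be : al \in compositions n -> be \in g al -> pre be = al.
  rewrite mem_compositions; case: al => [|[|b] al] /andP[_] //=.
    by rewrite inE => _ /eqP->.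
  by rewrite !inE => _ /orP[]/eqP->.
move=> _ _ /allpairsPdep[al [be [h1 h2 ->]]] /allpairsPdep[al' [be' [h1' h2' ->]]] /=.
by move=> bb; rewrite -(preK _ _ h1 h2) -(preK _ _ h1' h2') bb.
Qed.

Lemma coef_qfundamental al e : qfundamental al e = (refines (nonzero e) al)%:R.
Proof.
rewrite coef_big /=; have [r|r] := boolP (refines _ _); last first.
  rewrite big1 // => be rbe; rewrite /pmonomial; case: eqP => // ebe.
  by move: r; rewrite ebe rbe.
have [/eqP es _] := andP r; rewrite -big_filter.
rewrite (bigD1_seq (nonzero e)) ?filter_uniq ?compositions_uniq //=; last first.
  rewrite mem_filter r mem_compositions es eqxx.
  by apply/allP => k; rewrite mem_filter => /andP[].
rewrite /pmonomial eqxx big1 ?addr0 // => be.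
by rewrite eq_sym => /negPf->.
Qed.

Variables (E : finType) (lt : rel E) (lab : E -> nat).
Hypothesis strict : strict_labeling lt lab.

(** Every L has coefficients 0 or 1, so the coefficient counts the linear extensions that increase
    on the blocks of [e]; these are the block words. *)
Lemma coef_F_poset e : F_poset lt lab e = (count_maps lt setT e)%:R.
Proof.
have [lab_inj _ lab_lt] := strict.
rewrite coef_big; under eq_bigr => s _ do rewrite coef_qfundamental.
under eq_bigr => s _ do rewrite refines_run_lengths.
rewrite -natr_sum -big_mkcondr /= sum1dep_card; congr _%:R.
rewrite -(size_block_words lt lab) cardE -(size_map val).
apply/perm_size/uniq_perm.
- by rewrite map_inj_uniq ?enum_uniq //; apply: val_inj.
- exact: block_words_uniq.
move=> s; rewrite mem_block_words //.
have pe : enum [set: E] = enum E by apply: eq_enum => x; rewrite inE.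
apply/mapP/and3P => [[t]|[ps cs bs]].
  rewrite mem_enum inE => /andP[/andP[pt ct] bt] ->; split=> //; first by rewrite pe.
  apply/forall_inP => x _; apply/forall_inP => y _.
  by have /forallP/(_ x)/forallP/(_ y) := ct.
rewrite pe in ps; have ss : size s == #|E| by rewrite (perm_size ps) -cardE.
exists (Tuple ss) => //; rewrite mem_enum inE /= bs andbT.
apply/andP; split=> //; apply/forallP => x; apply/forallP => y.
by move/forall_inP/(_ x (in_setT _))/forall_inP/(_ y (in_setT _)): cs.
Qed.

End QSymCoefficients.

(** * Posets in which at most two elements lie below others *)

Section CountMaps.
Variables (E : finType) (lt : rel E).
Implicit Types (R A T V : {set E}) (e : seq nat).

(* The values of count_maps on an antichain of t elements, and on t isolated
   elements together with an element below v others (see count_antichain and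
   count_star). *)
Fixpoint antichain_count t e : nat :=
  if e is k :: e' then 'C(t, k) * antichain_count (t - k) e' else t == 0.

Fixpoint star_count t v e : nat :=
  if e is k :: e' then
    'C(t, k) * star_count (t - k) v e' +
    (if k is j.+1 then 'C(t, j) * antichain_count (t - j + v) e' else 0)
  else 0.

Lemma antichain_idealE R A :
  antichain_ideal lt R A =
  (A \subset [set y in R | [forall x in R, ~~ lt x y]]).
Proof.
rewrite /antichain_ideal; apply/andP/subsetP => [[/subsetP AR h] y yA|h].
  rewrite inE AR //=; apply/forall_inP => x xR.
  by move/forall_inP/(_ _ xR)/forall_inP/(_ _ yA): h.
split; first by apply/subsetP => y /h; rewrite inE => /andP[].
apply/forall_inP => x xR; apply/forall_inP => y /h; rewrite inE => /andP[_].
by move/forall_inP/(_ _ xR).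
Qed.

Lemma count_maps_cons R T k e :
  T =i [set y in R | [forall x in R, ~~ lt x y]] ->
  count_maps lt R (k :: e) =
  \sum_(A : {set E} | (A \subset T) && (#|A| == k)) count_maps lt (R :\: A) e.
Proof.
by move/setP => -> /=; apply: eq_bigl => A; rewrite antichain_idealE andbC.
Qed.

Lemma sum_subsets_const T k c (F : {set E} -> nat) :
  (forall A, A \subset T -> #|A| = k -> F A = c) ->
  \sum_(A : {set E} | (A \subset T) && (#|A| == k)) F A = 'C(#|T|, k) * c.
Proof.
move=> h; rewrite -cards_draws -sum_nat_const.
apply: eq_big => A; first by rewrite !inE.
by case/andP => AT /eqP; apply: h.
Qed.

Lemma sum_subsets_full T (F : {set E} -> nat) :
  \sum_(A : {set E} | (A \subset T) && (#|A| == #|T|)) F A = F T.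
Proof.
by rewrite (big_pred1 T) // => A; rewrite /= eqEcard eqn_leq;
  case: (boolP (A \subset T)) => //= /subset_leq_card ->.
Qed.

Lemma sum_subsets_gt T k (F : {set E} -> nat) : #|T| < k ->
  \sum_(A : {set E} | (A \subset T) && (#|A| == k)) F A = 0.
Proof.
move=> Tk; rewrite big1 // => A /andP[/subset_leq_card + /eqP Ak].
by rewrite Ak leqNgt Tk.
Qed.

Lemma sum_subsets_setU1 y T k (F : {set E} -> nat) : y \notin T ->
  \sum_(A : {set E} | (A \subset y |: T) && (#|A| == k)) F A =
  \sum_(A : {set E} | (A \subset T) && (#|A| == k)) F A +
  (if k is j.+1 then
     \sum_(A : {set E} | (A \subset T) && (#|A| == j)) F (y |: A) else 0).
Proof.
move=> yT; have nA A : A \subset T -> y \notin A.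
  by move=> AT; apply/negP => /(subsetP AT); apply/negP.
rewrite (bigID (fun A : {set E} => y \in A)) /= addnC; congr addn.
  apply: eq_bigl => A; rewrite andbAC; congr andb.
  rewrite -subsetD1 setU1K //.
case: k => [|k].
  rewrite big1 // => A /andP[/andP[_]]; rewrite cards_eq0 => /eqP->.
  by rewrite inE.
rewrite (reindex_onto (fun A : {set E} => y |: A) (fun A => A :\ y)) /=; last first.
  by move=> A /andP[_]; apply: setD1K.
apply: eq_bigl => A; rewrite setU11 andbT; apply/andP/andP.
  case=> /andP[AT kA] /eqP eA; have yA : y \notin A by rewrite -eA !inE eqxx.
  rewrite cardsU1 yA in kA; split=> //; apply/subsetP => z zA.
  have := subsetP AT z; rewrite !inE zA orbT => /(_ isT) /orP[/eqP zy|//].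
  by move: yA; rewrite -zy zA.
case=> AT /eqP kA; rewrite cardsU1 nA // kA setUS // eqxx.
by rewrite setU1K // nA.
Qed.

Lemma count_antichain R e :
  {in R &, forall x y, ~~ lt x y} -> count_maps lt R e = antichain_count #|R| e.
Proof.
elim: e R => [|k e IH] R h; first by rewrite /= cards_eq0.
rewrite (@count_maps_cons R R) => [|y]; last first.
  rewrite inE; case yR: (y \in R) => //=.
  by apply/esym/forall_inP => x xR; apply: h.
apply: sum_subsets_const => A AR kA; rewrite IH ?cardsDS ?kA //.
by move=> x y /setDP[xR _] /setDP[yR _]; apply: h.
Qed.

Lemma count_star R V y e : y \in R -> V \subset R -> y \notin V ->
  {in R &, forall u w, lt u w = (u == y) && (w \in V)} ->
  count_maps lt R e = star_count (#|R| - #|V| - 1) #|V| e.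
Proof.
move=> + VR yV; have VR' := subsetP VR.
elim: e R {VR} VR' => [|k e IH] R VR yR h.
  by rewrite /=; apply/eqP; rewrite eqb0; apply/set0Pn; exists y.
have sVR : V \subset R :\ y.
  by apply/subsetP => w wV; rewrite !inE VR // andbT; apply: contraNneq yV => <-.
set T := (R :\ y) :\: V.
have cT : #|T| = #|R| - #|V| - 1.
  by rewrite cardsDS // (cardsD1 y R) yR; lia.
rewrite (@count_maps_cons R (y |: T)) => [|w]; last first.
  rewrite !inE; have [->|wy] /= := eqVneq w y.
    rewrite yR; apply/esym/forall_inP => u uR.
    by rewrite h // (negPf yV) andbF.
  case wR: (w \in R); rewrite /= ?andbF // andbT.
  apply/idP/forall_inP => [wV u uR|]; first by rewrite h // (negPf wV) andbF.
  by move/(_ y yR); rewrite h // eqxx.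
rewrite sum_subsets_setU1; last by rewrite !inE eqxx andbF.
have TR A : A \subset T -> A \subset R.
  by move=> AT; apply: subset_trans AT _; rewrite /T setDDl subsetDl.
have yT A : A \subset T -> y \notin A.
  by move=> /subsetP AT; apply/negP => /AT; rewrite !inE eqxx andbF.
have VT A w : A \subset T -> w \in V -> w \notin A.
  by move=> /subsetP AT wV; apply/negP => /AT; rewrite !inE wV.
rewrite -cT /=; congr addn.
  apply: sum_subsets_const => A AT kA.
  rewrite (IH (R :\: A)); first last.
  - by move=> u w /setDP[uR _] /setDP[wR _]; apply: h.
  - by rewrite !inE yR yT.
  - by move=> w wV; rewrite inE VT // VR.
  by congr star_count; rewrite cardsDS ?TR // kA cT; lia.
case: k => [|k] //.
apply: sum_subsets_const => A AT kA.
rewrite count_antichain; last first.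
  move=> u w; rewrite !inE negb_or => /andP[/andP[uy _] uR] /andP[_ wR].
  by rewrite h // (negPf uy).
congr antichain_count; rewrite cardsDS; last by rewrite subUset sub1set yR TR.
rewrite cardsU1 yT // kA.
have := subset_leq_card AT; have := subset_leq_card sVR.
by rewrite cT kA (cardsD1 y R) yR; lia.
Qed.

Section TwoLayers.
(** The shape of P_B for B = {x, y}: [Ux] and [Uy], which may overlap, lie above [x] and [y], and
    [L] will be the set of loops. By [UE] the minimal elements are [x], [y] and those of [L]. *)
Variables (x y : E) (Ux Uy L : {set E}).
Hypothesis xy : x != y.
Hypothesis ltE : forall u w, lt u w = (u == x) && (w \in Ux) || (u == y) && (w \in Uy).
Hypothesis UE : Ux :|: Uy = ~: (x |: (y |: L)).
Hypothesis xL : x \notin L.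
Hypothesis yL : y \notin L.

Let UE' w : (w \in Ux) || (w \in Uy) = (w \notin x |: (y |: L)).
Proof. by rewrite -in_setU UE inE. Qed.

Let xU : (x \notin Ux) && (x \notin Uy).
Proof. by rewrite -negb_or UE' !inE eqxx. Qed.

Let yU : (y \notin Ux) && (y \notin Uy).
Proof. by rewrite -negb_or UE' !inE eqxx orbT. Qed.

Let minE : x |: (y |: L) =i [set w in [set: E] | [forall u in [set: E], ~~ lt u w]].
Proof.
move=> w; rewrite [RHS]inE in_setT /=; apply/idP/forall_inP => [|h].
  move=> wM u _; move: (UE' w); rewrite wM ltE /=; move/negbT.
  by rewrite negb_or => /andP[/negPf-> /negPf->]; rewrite !andbF.
apply/negPn; rewrite -UE'; apply/negP => /orP[wU|wU].
  by have := h x (in_setT _); rewrite ltE eqxx wU.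
by have := h y (in_setT _); rewrite ltE eqxx wU orbT.
Qed.

(** The four sums have first fibers containing neither of [x] and [y], only [y], only [x], and
    both. *)
Let sumE k e : count_maps lt [set: E] (k :: e) =
  \sum_(A : {set E} | (A \subset L) && (#|A| == k)) count_maps lt (~: A) e +
  (if k is j.+1 then
    \sum_(A : {set E} | (A \subset L) && (#|A| == j)) count_maps lt (~: (y |: A)) e
   else 0) +
  (if k is j.+1 then
    \sum_(A : {set E} | (A \subset L) && (#|A| == j)) count_maps lt (~: (x |: A)) e +
    (if j is i.+1 then
       \sum_(A : {set E} | (A \subset L) && (#|A| == i)) count_maps lt (~: (x |: (y |: A))) e
     else 0)
   else 0).
Proof.
rewrite (count_maps_cons _ _ minE).
under eq_bigr => A _ do rewrite setTD.
rewrite sum_subsets_setU1; last by rewrite !inE negb_or xy.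
rewrite sum_subsets_setU1 //; congr addn.
by case: k => [|k] //; rewrite sum_subsets_setU1.
Qed.

Let antichainE A e : count_maps lt (~: (x |: (y |: A))) e =
  antichain_count (#|E| - #|x |: (y |: A)|) e.
Proof.
rewrite count_antichain.
  by congr antichain_count; rewrite -[#|E|](cardsC (x |: (y |: A))) addKn.
move=> u w; rewrite !inE !negb_or => /and3P[ux uy _] _.
by rewrite ltE (negPf ux) (negPf uy).
Qed.

Let card_xyL A : A \subset L -> #|x |: (y |: A)| = #|A|.+2.
Proof.
move=> AL; have nA z : z \notin L -> z \notin A by apply/contraNN/(subsetP AL).
by rewrite !cardsU1 !inE negb_or xy !nA.
Qed.

(** Just one of the [#|L|.+2] minimal elements stays out of the first fiber. If it is [x] or [y], a
    star remains; if it lies in [L], an antichain remains. *)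
Lemma count_two_layers_1 e :
  count_maps lt [set: E] (#|L|.+1 :: e) =
  star_count (#|E| - #|L| - #|Ux| - 2) #|Ux| e +
  star_count (#|E| - #|L| - #|Uy| - 2) #|Uy| e +
  #|L| * antichain_count (#|E| - #|L|.+1) e.
Proof.
rewrite sumE sum_subsets_gt // add0n !sum_subsets_full addnA.
have [/andP[xUx xUy] /andP[yUx yUy]] := conj xU yU.
have UL w : (w \in Ux) || (w \in Uy) -> w \notin L.
  by rewrite UE' !inE !negb_or => /and3P[].
have cardC z : z \notin L -> #|~: (z |: L)| = #|E| - #|L|.+1.
  by move=> zL; rewrite -[#|E|](cardsC (z |: L)) cardsU1 zL addKn.
congr (_ + _ + _).
- rewrite (@count_star _ Ux x) //.
  + by congr star_count; rewrite cardC //; lia.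
  + by rewrite !inE negb_or xy xL.
  + apply/subsetP => w wU; rewrite !inE negb_or UL ?wU // andbT.
    by apply: contraNneq yUx => <-.
  move=> u w; rewrite !inE !negb_or => /andP[uy _] _.
  by rewrite ltE (negPf uy) orbF.
- rewrite (@count_star _ Uy y) //.
  + by congr star_count; rewrite cardC //; lia.
  + by rewrite !inE negb_or eq_sym xy yL.
  + apply/subsetP => w wU; rewrite !inE negb_or UL ?wU ?orbT // andbT.
    by apply: contraNneq xUy => <-.
  move=> u w; rewrite !inE !negb_or => /andP[ux _] _.
  by rewrite ltE (negPf ux).
case eL: #|L| => [|l]; first by rewrite mul0n.
transitivity ('C(#|L|, l) * antichain_count (#|E| - l.+2) e); last first.
  by rewrite eL binSn.
by apply: sum_subsets_const => A AL kA; rewrite antichainE card_xyL // kA.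
Qed.

Lemma count_two_layers_2 e :
  count_maps lt [set: E] (#|L|.+2 :: e) = antichain_count (#|E| - #|L|.+2) e.
Proof.
rewrite sumE (@sum_subsets_gt _ _.+2) // !(@sum_subsets_gt _ _.+1) //.
by rewrite !add0n sum_subsets_full antichainE card_xyL.
Qed.

Lemma count_two_layers_gt k e : #|L|.+2 < k ->
  count_maps lt [set: E] (k :: e) = 0.
Proof.
move=> Lk; rewrite sumE; case: k Lk => [|[|k]] Lk; try lia.
by rewrite !sum_subsets_gt //; lia.
Qed.

End TwoLayers.
End CountMaps.

(** * Matroids of rank two *)

Section MatroidBases.
Local Open Scope nat_scope.
Variables (E : finType) (M : matroid E).
Implicit Types (B : {set E}) (e : seq nat).

Lemma bases_exchange B1 B2 x :
  B1 \in bases M -> B2 \in bases M -> x \in B1 -> x \notin B2 ->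
  exists y, [/\ y \in B2, y \notin B1 & y |: (B1 :\ x) \in bases M].
Proof.
move=> h1 h2 x1 x2; have /is_basesP[_ /(_ _ _ h1 h2 x)] := valP M.
rewrite inE x1 x2 => /(_ isT)[y]; rewrite inE => /andP[? ?] ?.
by exists y; split.
Qed.

Lemma card_bases B1 B2 : B1 \in bases M -> B2 \in bases M -> #|B1| = #|B2|.
Proof.
move: {2}#|B1 :\: B2| (erefl #|B1 :\: B2|) => n.
elim: n B1 => [|n IH] B1 hn h1 h2.
  have s12 : B1 \subset B2 by rewrite -setD_eq0 -cards_eq0 hn.
  suff -> : B1 = B2 by [].
  apply/eqP; rewrite eqEsubset s12; apply/subsetP => y y2.
  apply/negPn/negP => y1; have [x [x1 + _]] := bases_exchange h2 h1 y2 y1.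
  by rewrite (subsetP s12).
have /set0Pn[x] : B1 :\: B2 != set0 by rewrite -cards_eq0 hn.
rewrite inE => /andP[x2 x1].
have [y [y2 y1 hy]] := bases_exchange h1 h2 x1 x2.
rewrite -(IH _ _ hy h2); last first.
  apply/eqP; rewrite -eqSS -hn [#|B1 :\: B2|](cardsD1 x) inE x1 x2 add1n eqSS.
  apply/eqP; congr #|pred_of_set _|; apply/setP => z; rewrite !inE.
  by case: (eqVneq z y) => [->|_] /=; rewrite ?y2 ?andbF //;
    do ?case: (_ \in _); do ?case: (_ == _).
by rewrite cardsU1 !inE (negPf y1) andbF /= [#|B1|](cardsD1 x) x1.
Qed.

Hypothesis rank2 : rank M = 2.

Lemma card_basis2 B : B \in bases M -> #|B| = 2.
Proof.
move=> hB; rewrite -rank2; apply/eqP; rewrite eqn_leq leq_bigmax_cond //=.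
by apply/bigmax_leqP => B' hB'; rewrite (card_bases hB' hB).
Qed.

Definition adj x y := [set x; y] \in bases M.
Definition nbhd x := [set y | adj x y].
Definition deg x := #|nbhd x|.
Definition loops := [set x | nbhd x == set0].

Lemma adjC x y : adj x y = adj y x.
Proof. by rewrite /adj setUC. Qed.

Lemma adj_neq x y : adj x y -> x != y.
Proof. by move/card_basis2; rewrite cards2; case: eqP. Qed.

(** Exchange [w] in the basis {z, w} against {x, y}. Hence nonadjacency is transitive among
    nonloops, and the graph is complete multipartite. *)
Lemma adj_trans x y z w : adj x y -> adj z w -> adj z x || adj z y.
Proof.
move=> xy zw; have [<-|wx] := eqVneq w x; first by rewrite zw.
have [<-|wy] := eqVneq w y; first by rewrite zw orbT.
have [||v [+ _]] := bases_exchange (x := w) zw xy.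
- by rewrite !inE eqxx orbT.
- by rewrite !inE negb_or wx.
have -> : v |: [set z; w] :\ w = [set z; v].
  apply/setP => u; rewrite !inE; have [->|uw] /= := eqVneq u w.
    by rewrite [w == z]eq_sym (negPf (adj_neq zw)) orbF.
  by rewrite orbF orbC.
by rewrite !inE => /orP[]/eqP->; rewrite -/(adj _ _) => ->; rewrite ?orbT.
Qed.

Lemma deg_gt0 x : (0 < deg x) = (x \notin loops).
Proof. by rewrite inE card_gt0. Qed.

Lemma adj_loops x y : adj x y -> x \notin loops.
Proof. by move=> xy; rewrite inE; apply/set0Pn; exists y; rewrite inE. Qed.

Lemma nonloopP x : reflect (exists y, adj x y) (x \notin loops).
Proof.
rewrite inE; apply: (iffP (set0Pn _)) => -[y]; last by exists y; rewrite inE.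
by rewrite inE; exists y.
Qed.

Lemma basis_pair B : B \in bases M -> exists x y, adj x y /\ B = [set x; y].
Proof.
move=> hB; have /eqP/cards2P[x [y [_ Bxy]]] := card_basis2 hB.
by exists x, y; rewrite /adj -Bxy.
Qed.

Lemma nonadj_nbhd x y : x \notin loops -> y \notin loops ->
  ~~ adj x y -> nbhd x = nbhd y.
Proof.
move=> /nonloopP[x' xx'] /nonloopP[y' yy'] nxy; apply/setP => z; rewrite !inE.
apply/idP/idP => h.
  by have := adj_trans h yy'; rewrite (adjC y x) (negPf nxy).
by have := adj_trans h xx'; rewrite (negPf nxy).
Qed.

(** Nonadjacent nonloops have the same neighbourhood, so [nbhd] can serve as the name of a parallel
    class. *)
Lemma adjE x y :
  adj x y = [&& nbhd x != nbhd y, x \notin loops & y \notin loops].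
Proof.
apply/idP/and3P => [xy|[nxy xl yl]]; last first.
  by apply/negPn/negP => /(nonadj_nbhd xl yl)/eqP; apply/negP.
split; try exact: adj_loops xy; last by rewrite adjC in xy; apply: adj_loops xy.
apply/eqP => /setP/(_ y); rewrite !inE xy => /esym/adj_neq.
by rewrite eqxx.
Qed.

Definition nonloop_number := #|E| - #|loops|.

Lemma card_nonloops : #|~: loops| = nonloop_number.
Proof. by rewrite /nonloop_number -[#|E|](cardsC loops) addKn. Qed.

Lemma deg_lt x : x \notin loops -> deg x < nonloop_number.
Proof.
move=> xl; rewrite -card_nonloops [X in _ < X](cardsD1 x) inE xl ltnS.
apply: subset_leq_card; apply/subsetP => y; rewrite inE => xy.
by rewrite in_setD1 in_setC eq_sym adj_neq //= (@adj_loops _ x) // adjC.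
Qed.

Section BasisOrder.
Variables x y : E.
Hypothesis xy : adj x y.
Let B := [set x; y].

(** Replacing [x] by [w] in {x, y} gives {y, w}, so the elements above [x] are neighbours of [y],
    and symmetrically. *)
Lemma base_lt_pair u w : base_lt M B u w =
  (u == x) && (w \in nbhd y :\ x) || (u == y) && (w \in nbhd x :\ y).
Proof.
have nxy := adj_neq xy; rewrite /base_lt !inE negb_or.
have swap z t : t != z -> w |: ([set z; t] :\ z) = [set t; w].
  move=> tz; apply/setP => v; rewrite !inE; have [->|] := eqVneq v z.
    by rewrite [z == t]eq_sym (negPf tz) /= orbF.
  by rewrite /= orbC.
have noadj z : adj z z = false by apply/negP => /adj_neq; rewrite eqxx.
have [->|ux] := eqVneq u x.
  rewrite (negPf nxy) /= orbF /B swap 1?eq_sym // -/(adj y w).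
  by have [->|] := eqVneq w y; rewrite ?noadj ?andbF //= andbT.
have [->|uy] //= := eqVneq u y.
rewrite /B (setUC [set x]) swap // -/(adj x w).
by have [->|] := eqVneq w x; rewrite ?noadj ?andbF.
Qed.

Lemma base_lt_cover :
  (nbhd y :\ x) :|: (nbhd x :\ y) = ~: (x |: (y |: loops)).
Proof.
have nxy := adj_neq xy; have xl := adj_loops xy; have yx := xy.
rewrite adjC in yx; have yl := adj_loops yx.
have noadj z : adj z z = false by apply/negP => /adj_neq; rewrite eqxx.
apply/setP => w; rewrite in_setU !in_setD1 in_setC !in_setU1 !negb_or.
rewrite [w \in nbhd y]inE [w \in nbhd x]inE.
have [->|wx] /= := eqVneq w x; first by rewrite noadj andbF.
have [->|wy] /= := eqVneq w y; first by rewrite noadj.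
apply/orP/idP => [[]|/nonloopP[v wv]]; rewrite ?(adjC _ w); try exact: adj_loops.
by apply/orP; rewrite orbC (adj_trans xy wv).
Qed.

Lemma card_nbhdD1 : #|nbhd y :\ x| = (deg y).-1.
Proof. by rewrite /deg [#|nbhd y|](cardsD1 x) inE adjC xy. Qed.

End BasisOrder.

(** In a basis {x, y}, once the loops and [x] are removed, [y] lies below the other [(deg x).-1]
    neighbours of [x], and the remaining nonloops are isolated. So the count depends on [x] through
    its degree only. *)
Definition star_term e x := star_count (nonloop_number - deg x - 1) (deg x).-1 e.

Lemma sum_bases_pair (h : E -> nat) :
  \sum_(B in bases M) \sum_(x in B) h x = \sum_x deg x * h x.
Proof.
rewrite (exchange_big_dep predT) //=; apply: eq_bigr => x _.
rewrite sum_nat_const; congr muln.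
have -> : deg x = #|[set [set x; y] | y in nbhd x]|.
  rewrite card_in_imset // => y z; rewrite !inE => xy xz /setP/(_ y).
  by rewrite !inE eqxx orbT eq_sym (negPf (adj_neq xy)) => /esym/eqP.
apply: eq_card => B; apply/andP/imsetP => [[hB xB]|[y]].
  have [u [v [uv Buv]]] := basis_pair hB; move: xB; rewrite Buv !inE.
  case/orP=> /eqP ->; first by exists v; rewrite ?inE.
  by exists u; rewrite ?inE 1?adjC // setUC.
by rewrite inE => xy ->; rewrite !inE eqxx.
Qed.

Local Notation count B := (count_maps (base_lt M B) [set: E]).

Lemma coef_F_matroid e :
  F_matroid M e = (\sum_(B in bases M) count B e)%N%:R%R.
Proof.
rewrite coef_big natr_sum; apply: eq_bigr => B _.
by rewrite coef_F_poset //; apply: base_label_strict.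
Qed.

Let layers x y (xy : adj x y) :=
  conj (conj (adj_neq xy) (base_lt_pair xy))
       (conj (base_lt_cover xy) (conj (adj_loops xy) (adj_loops (etrans (adjC y x) xy)))).

Lemma coef_F_matroid_1 e : F_matroid M (#|loops|.+1 :: e) =
  (\sum_x deg x * star_term e x +
   #|bases M| * (#|loops| * antichain_count (nonloop_number - 1) e))%N%:R%R.
Proof.
rewrite coef_F_matroid -sum_bases_pair -sum_nat_const -big_split.
congr (_%:R)%R; apply: eq_bigr => B /basis_pair[x [y [xy ->]]].
have [[nxy ltB] [cov [xl yl]]] := layers xy.
rewrite [RHS]/= (count_two_layers_1 nxy ltB cov xl yl) big_setU1 ?inE // big_set1 /star_term.
have yx := xy; rewrite adjC in yx.
rewrite !card_nbhdD1 // /nonloop_number addnC [star_count _ _ _ + _]addnC addnC.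
have dx : 0 < deg x by rewrite deg_gt0.
have dy : 0 < deg y by rewrite deg_gt0.
by congr (star_count _ _ _ + star_count _ _ _ + _ * antichain_count _ _); lia.
Qed.

Lemma coef_F_matroid_2 e : F_matroid M (#|loops|.+2 :: e) =
  (#|bases M| * antichain_count (nonloop_number - 2) e)%N%:R%R.
Proof.
rewrite coef_F_matroid -sum_nat_const.
congr (_%:R)%R; apply: eq_bigr => B /basis_pair[x [y [xy ->]]].
have [[nxy ltB] [cov [xl yl]]] := layers xy.
rewrite (count_two_layers_2 nxy ltB cov xl yl) /nonloop_number.
by congr antichain_count; lia.
Qed.

Lemma coef_F_matroid_gt k e : #|loops|.+2 < k -> F_matroid M (k :: e) = 0%R.
Proof.
move=> lk; rewrite coef_F_matroid big1 // => B /basis_pair[x [y [xy ->]]].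
have [[nxy ltB] [cov [xl yl]]] := layers xy.
exact: (count_two_layers_gt nxy ltB cov xl yl).
Qed.

Lemma sum_deg : \sum_x deg x = 2 * #|bases M|.
Proof.
under eq_bigr do rewrite -[deg _]muln1.
rewrite -(sum_bases_pair (fun=> 1)) mulnC -sum_nat_const; apply: eq_bigr => B hB.
by rewrite sum1_card (card_basis2 hB).
Qed.

Lemma card_bases_gt0 : 0 < #|bases M|.
Proof. by rewrite card_gt0; have /is_basesP[] := valP M. Qed.

End MatroidBases.

(** * Derivations of QSym *)

Section NewtonDerivations.
Local Open Scope ring_scope.
Local Open Scope quotient_scope.
Implicit Types (f g : pseries) (e : seq nat).

(* Entry k, counted from 0, is the derivation P_(k+1): Newton's identity solved for it. *)
Fixpoint newton_list n : seq (pseries -> pseries) :=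
  if n is m.+1 then
    let s := newton_list m in
    rcons s (fun f e => m.+1%:R * f (m.+1 :: e) -
                        \sum_(j < m) nth id s j f ((m - j)%N :: e))
  else [::].

(** The index is shifted: [newton d] is P_(d+1). The list is kept because the recursion uses all the
    earlier operators. *)
Definition newton d : pseries -> pseries := nth id (newton_list d.+1) d.

Lemma size_newton_list n : size (newton_list n) = n.
Proof. by elim: n => //= n IH; rewrite size_rcons IH. Qed.

Lemma nth_newton_list n j : (j < n)%N -> nth id (newton_list n) j = newton j.
Proof.
elim: n => // n IH; rewrite ltnS leq_eqVlt => /orP[/eqP->//|jn].
by rewrite /= nth_rcons size_newton_list jn IH.
Qed.

Lemma newtonE d f e :
  newton d f e = d.+1%:R * f (d.+1 :: e) - \sum_(j < d) newton j f ((d - j)%N :: e).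
Proof.
rewrite {1}/newton /= nth_rcons size_newton_list ltnn eqxx.
by congr (_ - _); apply: eq_bigr => j _; rewrite nth_newton_list.
Qed.

Lemma quasisymmetric_newton d f : quasisymmetric f -> quasisymmetric (newton d f).
Proof.
move=> qf; elim/ltn_ind: d => d IH x y xy; rewrite !newtonE.
have cons k : nonzero (k :: x) = nonzero (k :: y) by rewrite /= xy.
congr (_ * _ - _); first exact: qf.
by apply: eq_bigr => j _; apply: IH.
Qed.

Lemma quasisymmetric_0 f e : quasisymmetric f -> f (0%N :: e) = f e.
Proof. by move=> qf; apply: qf. Qed.

(** Newton's identity in its usual form: by quasisymmetry T_0 is the identity, so the solved-for
    term joins the sum. *)
Lemma newton_sum d f e : quasisymmetric f ->
  \sum_(j < d.+1) newton j f ((d - j)%N :: e) = d.+1%:R * f (d.+1 :: e).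
Proof.
move=> qf; rewrite big_ord_recr /= subnn.
rewrite quasisymmetric_0 ?newtonE ?subrKC //; last exact: quasisymmetric_newton.
Qed.

(** Newton's identities determine the P_d one after the other, so a closed formula for them is
    proved by checking these identities. *)
Lemma newton_unique f (G : nat -> pseries) :
  (forall d e, G d (0%N :: e) = G d e) ->
  (forall d e, \sum_(j < d.+1) G j ((d - j)%N :: e) = d.+1%:R * f (d.+1 :: e)) ->
  forall d, newton d f = G d.
Proof.
move=> G0 GE; elim/ltn_ind => d IH; apply/funext => e.
rewrite newtonE -GE big_ord_recr /= subnn G0 addrC.
under [X in _ - X]eq_bigr => j _ do rewrite IH //.
by rewrite addrK.
Qed.

Lemma newton_linear d (I : Type) (r : seq I) (a : I -> rat) (f : I -> pseries) e :
  newton d (fun e => \sum_(i <- r) a i * f i e) e =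
  \sum_(i <- r) a i * newton d (f i) e.
Proof.
elim/ltn_ind: d e => d IH e; rewrite newtonE.
under [X in _ - X]eq_bigr => j _ do rewrite IH //.
rewrite exchange_big /= mulr_sumr -sumrB; apply: eq_bigr => i _.
by rewrite newtonE mulrBr mulr_sumr mulrCA.
Qed.

Lemma newton_add d f g : newton d (f + g) = newton d f + newton d g.
Proof.
apply/funext; elim/ltn_ind: d => d IH e.
rewrite [RHS](_ : _ = newton d f e + newton d g e) // !newtonE.
under eq_bigr => j _ do rewrite IH //.
rewrite [(f + g) _](_ : _ = f (d.+1 :: e) + g (d.+1 :: e)) // mulrDr.
rewrite [X in _ - X](_ : _ = \sum_(j < d) newton j f ((d - j)%N :: e) +
   \sum_(j < d) newton j g ((d - j)%N :: e)); last by rewrite -big_split.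
by rewrite opprD addrACA.
Qed.

(** These are the terms of Newton's identity for a product in which the derivation acts on [f].
    Grouped by s = i + j, they contain the whole identity for [f] at [s]. *)
Lemma sum_newton_mul d f g e : quasisymmetric f ->
  \sum_(j < d.+1) \sum_(i < (d - j).+1)
    pmul (ptail i (newton j f)) (ptail (d - j - i) g) e =
  \sum_(s < d.+1) s.+1%:R * pmul (ptail s.+1 f) (ptail (d - s) g) e.
Proof.
move=> qf.
rewrite (sum_triangle d (fun j i =>
  pmul (ptail i (newton j f)) (ptail (d - j - i) g) e)).
apply: eq_bigr => s _.
under eq_bigr => j _ do rewrite -subnDA subnKC -1?ltnS //.
rewrite -pmul_suml.
rewrite [X in pmul X](_ : _ = fun e => s.+1%:R * ptail s.+1 f e).
  by rewrite /pmul mulr_sumr; apply: eq_bigr => p _; rewrite mulrA.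
by apply/funext => u; rewrite [LHS]newton_sum.
Qed.

Lemma newton_mul d f g : quasisymmetric f -> quasisymmetric g ->
  newton d (pmul f g) = pmul (newton d f) g + pmul f (newton d g).
Proof.
move=> qf qg; apply: (newton_unique (G := fun d =>
   pmul (newton d f) g + pmul f (newton d g))) => {d} d e.
  have q h : quasisymmetric h -> h (0%N :: e) = h e by move=> qh; apply: qh.
  have add (u v : pseries) w : (u + v) w = u w + v w by [].
  by rewrite !add !q //; apply: quasisymmetric_mul => //; apply: quasisymmetric_newton.
transitivity (\sum_(j < d.+1) \sum_(i < (d - j).+1)
    pmul (ptail i (newton j f)) (ptail (d - j - i) g) e +
  \sum_(j < d.+1) \sum_(i < (d - j).+1)
    pmul (ptail i (newton j g)) (ptail (d - j - i) f) e).
  rewrite -big_split /=; apply: eq_bigr => j _.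
  rewrite [LHS](_ : _ = pmul (newton j f) g ((d - j)%N :: e) +
    pmul (newton j g) f ((d - j)%N :: e)); last by rewrite [pmul (newton j g) f]pmulC.
  by rewrite !pmul_cons.
rewrite !sum_newton_mul // pmul_cons.
(* The part acting on [f] gives [A i] the weight i, the part acting on [g] the weight d + 1 - i;
   together they make d + 1 times T_(d+1) of the product. *)
pose A i := pmul (ptail i f) (ptail (d.+1 - i) g) e.
have -> : \sum_(s < d.+1) s.+1%:R * pmul (ptail s.+1 f) (ptail (d - s) g) e =
    \sum_(i < d.+2) i%:R * A i.
  by rewrite [RHS]big_ord_recl mul0r add0r; apply: eq_bigr => s _.
have -> : \sum_(s < d.+1) s.+1%:R * pmul (ptail s.+1 g) (ptail (d - s) f) e =
    \sum_(i < d.+2) (d.+1 - i)%:R * A i.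
  rewrite [RHS]big_ord_recr /= subnn mul0r addr0 (reindex_inj rev_ord_inj) /=.
  apply: eq_bigr => s _; rewrite pmulC subSS -subSn; last by rewrite -ltnS.
  by rewrite subKn // -ltnS.
rewrite -big_split mulr_sumr; apply: eq_bigr => i _ /=.
by rewrite -mulrDl -natrD subnKC // -ltnS.
Qed.

(* The bracket of two left-invariant derivations, followed by the counit. *)
Definition newton_bracket c d f : rat :=
  newton d (newton c f) [::] - newton c (newton d f) [::].

Lemma newton_bracket_add c d f g :
  newton_bracket c d (f + g) = newton_bracket c d f + newton_bracket c d g.
Proof.
rewrite /newton_bracket !newton_add.
have add (u v : pseries) w : (u + v) w = u w + v w by [].
by rewrite !add opprD addrACA.
Qed.

(** A commutator of derivations is a derivation: the mixed terms cancel, and what is left has a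
    factor [f [::]] or [g [::]]. *)
Lemma newton_bracket_mul c d f g : quasisymmetric f -> quasisymmetric g ->
  f [::] = 0 -> g [::] = 0 -> newton_bracket c d (pmul f g) = 0.
Proof.
move=> qf qg f0 g0; have qn h := quasisymmetric_newton h.
rewrite /newton_bracket !newton_mul // !newton_add !newton_mul //; do ?exact: qn.
have add (u v : pseries) w : (u + v) w = u w + v w by [].
rewrite !add !pmul_nil f0 g0 !mul0r !mulr0 !add0r !addr0.
by rewrite [X in X - _]addrC subrr.
Qed.

Lemma newton_bracket_m2 c d (h : QSym) : qsym_m2 h -> newton_bracket c d h = 0.
Proof.
case=> n [f [g [hf hg ->]]].
have nb0 : newton_bracket c d (0 : QSym) = 0.
  apply: (addrI (newton_bracket c d (0 : QSym))); rewrite addr0.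
  by rewrite -newton_bracket_add; congr newton_bracket; apply: addr0.
elim/big_rec: _ => [//|i x _ IH].
rewrite [coefs _](_ : _ = pmul (f i) (g i) + coefs x) //.
rewrite newton_bracket_add IH addr0 newton_bracket_mul //.
- exact: (qsymP _).1.
- exact: (qsymP _).1.
- exact/qsym_mP.
- exact/qsym_mP.
Qed.

Lemma newton_bracket_pi c d (F G : QSym) :
  \pi_QSym_m2 F = \pi_QSym_m2 G -> newton_bracket c d F = newton_bracket c d G.
Proof.
move=> FG; apply/eqP; rewrite -subr_eq0; apply/eqP.
have m2 : qsym_m2 (F - G).
  by apply/asboolP; have /eqP := FG; rewrite -Quotient.idealrBE.
have FE : newton_bracket c d F = newton_bracket c d (F - G : QSym) + newton_bracket c d G.
  by rewrite -newton_bracket_add -[in LHS](subrK G F).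
by rewrite FE newton_bracket_m2 // add0r subrr.
Qed.

End NewtonDerivations.

(** * The derivations on F of a loopless rank two matroid *)

Section NewtonMatroid.
Local Open Scope ring_scope.

(** Compare the coefficients of z^d in (1 + z)^t ((1 + z) - z)^v = (1 + z)^t. The proof is by
    induction on [v] with Pascal's rule. *)
Lemma sum_bin_alternating t v d :
  \sum_(j < d.+1) (-1) ^+ j * ('C(v, j) * 'C(t + v - j, d - j))%N%:R =
  'C(t, d)%:R :> rat.
Proof.
elim: v t d => [|v IH] t d.
  rewrite big_ord_recl /= bin0 mul1n addn0 !subn0 mul1r big1 ?addr0 // => j _.
  by rewrite bin0n /= mulr0.
case: d => [|d]; first by rewrite big_ord1 !bin0 mulr1.
transitivity ('C(t.+1, d.+1)%:R - 'C(t, d)%:R : rat); last first.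
  by rewrite binS natrD addrK.
rewrite -IH -(IH t d) [LHS]big_ord_recl [X in _ = X - _]big_ord_recl /=.
rewrite !bin0 !subn0 addSnnS -addrA; congr (_ + _).
rewrite -sumrB; apply: eq_bigr => j _.
rewrite /bump /= add1n binS subSS addnS subSS mulnDl natrD mulrDr; congr (_ + _).
by rewrite exprS mulN1r mulNr.
Qed.

(** As a series, [star_count t v] is p_1^t times the series of a single star, where p_1 is the sum
    of the variables. The derivation sends p_1 to 1 if d = 0 and to 0 otherwise, whence the first
    term; the second comes from the star. *)
Lemma newton_star d t v :
  newton d (fun e => (star_count t v e)%:R) =
  fun e => (d == 0%N)%:R * (t * star_count t.-1 v e)%N%:R +
           (-1) ^+ d * ('C(v, d) * antichain_count (t + v - d) e)%N%:R.
Proof.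
apply: (newton_unique (G := fun d e =>
  (d == 0%N)%:R * (t * star_count t.-1 v e)%N%:R +
  (-1) ^+ d * ('C(v, d) * antichain_count (t + v - d) e)%N%:R)) => {}d e.
  by rewrite /= !bin0 !mul1n !subn0 addn0.
rewrite big_split /= big_ord_recl /= subn0 mul1r [X in _ + X + _]big1; last first.
  by move=> j _; rewrite mul0r.
rewrite addr0.
have -> : \sum_(j < d.+1) (-1) ^+ j * ('C(v, j) *
    ('C(t + v - j, d - j) * antichain_count (t + v - j - (d - j)) e))%N%:R =
    ('C(t, d) * antichain_count (t + v - d) e)%N%:R :> rat.
  rewrite natrM -(sum_bin_alternating t v d) mulr_suml; apply: eq_bigr => j _.
  by rewrite mulnA [in LHS]natrM mulrA -subnDA subnKC // -ltnS.
rewrite -natrD -natrM; congr _%:R.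
have -> : ('C(t, d) * antichain_count (t + v - d) e =
           'C(t, d) * antichain_count (t - d + v) e)%N.
  have [td|td] := leqP d t; last by rewrite bin_small // !mul0n.
  by rewrite addnBAC.
(* By absorption, t C(t-1, d) = (d+1) C(t, d+1), the first term gives d + 1 copies of the star part
   but d copies of the antichain part; the sum just evaluated is the missing copy. *)
rewrite !mulnDr [in RHS]mulnA -mul_bin_diag -mulnA.
have -> : (t.-1 - d = t - d.+1)%N by lia.
rewrite -addnA; congr (_ + _)%N.
case: d => [|d]; first by rewrite !bin0 muln0 add0n !mul1n.
have -> : (t.-1 - d = t - d.+1)%N by lia.
by rewrite mulnA mul_bin_diag -mulnA -mulSnr.
Qed.

Variables (E : finType) (M : matroid E).
Hypotheses (rank2 : rank M = 2) (loopless : loops M = set0).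

Let loops0 : #|loops M| = 0%N. Proof. by rewrite loopless cards0. Qed.

Lemma nonloop_number_card : nonloop_number M = #|E|.
Proof. by rewrite /nonloop_number loops0 subn0. Qed.

Lemma loopless_deg_gt0 x : (0 < deg M x)%N.
Proof. by rewrite deg_gt0 loopless inE. Qed.

Lemma loopless_deg_lt x : (deg M x < #|E|)%N.
Proof. by rewrite -nonloop_number_card deg_lt // loopless inE. Qed.

(** For each [x] the alternating binomial sums leave a star for d = 0, an antichain for d = 1, and
    nothing for larger d. Summed over [x] these are T_1 and 2 T_2 of F, and the higher T_k of F
    vanish. *)
Lemma newton_F_matroid d :
  newton d (F_matroid M) = fun e =>
  \sum_x ((-1) ^+ d * ('C(#|E| - deg M x - 1, d) * deg M x)%N%:R) *
    (star_count (#|E| - deg M x - 1 - d) (deg M x).-1 e)%:R.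
Proof.
apply: (newton_unique (G := fun d e => \sum_x
    ((-1) ^+ d * ('C(#|E| - deg M x - 1, d) * deg M x)%N%:R) *
    (star_count (#|E| - deg M x - 1 - d) (deg M x).-1 e)%:R)) => {}d e.
  by apply: eq_bigr => x _ /=; rewrite bin0 mul1n subn0 addn0.
rewrite exchange_big /=.
have alt a : \sum_(j < d.+1) (-1) ^+ j * ('C(a, j) * 'C(a - j, d - j))%N%:R =
    (d == 0%N)%:R :> rat.
  by have := sum_bin_alternating 0 a d; rewrite add0n bin0n eq_sym.
have inner a b v : \sum_(j < d.+1) ((-1) ^+ j * ('C(a, j) * b)%N%:R) *
      (star_count (a - j) v ((d - j)%N :: e))%:R =
    (b * ((d == 0%N) * star_count a v e +
          (d == 1%N) * antichain_count (a + v) e))%N%:R :> rat.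
  transitivity (\sum_(j < d.+1) ((-1) ^+ j * ('C(a, j) * 'C(a - j, d - j))%N%:R) *
      (b * star_count (a - d) v e)%N%:R +
    \sum_(j < d.+1) ((-1) ^+ j * ('C(a, j) * b)%N%:R) *
      (if (d - j)%N is i.+1 then
         'C(a - j, i) * antichain_count (a - j - i + v) e else 0)%N%:R : rat).
    rewrite -big_split; apply: eq_bigr => j _ /=.
    rewrite natrD mulrDr -subnDA subnKC -1?ltnS //; congr (_ + _).
    by rewrite -!mulrA -!natrM; congr (_ * _%:R); lia.
  rewrite -mulr_suml alt -!natrM mulnDr natrD; congr (_ + _).
    by case: eqP => [->|_]; rewrite ?mul0n ?muln0 // !mul1n subn0.
  case: d alt => [|d] alt; first by rewrite big_ord1 /= mulr0 mul0n muln0.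
  rewrite big_ord_recr /= subnn mulr0 addr0.
  transitivity (\sum_(j < d.+1) ((-1) ^+ j * ('C(a, j) * 'C(a - j, d - j))%N%:R) *
      (b * antichain_count (a - d + v) e)%N%:R : rat).
    apply: eq_bigr => j _; have jd : (j <= d)%N by rewrite -ltnS.
    rewrite subSn // -subnDA subnKC // -!mulrA -!natrM; congr (_ * _%:R); lia.
  rewrite -mulr_suml; have := sum_bin_alternating 0 a d.
  rewrite add0n bin0n => ->; rewrite -natrM eqSS.
  by case: eqP => [->|_]; rewrite ?mul0n ?muln0 // !mul1n subn0.
under eq_bigr => x _ do rewrite inner.
rewrite -natr_sum.
case: d {alt inner} => [|[|d]].
- have F1 := coef_F_matroid_1 rank2 e; rewrite loops0 in F1.
  rewrite mul1r F1 mul0n muln0 addn0.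
  congr _%:R; apply: eq_bigr => x _.
  by rewrite mul1n mul0n addn0 /star_term nonloop_number_card.
- have F2 := coef_F_matroid_2 rank2 e; rewrite loops0 in F2.
  rewrite F2 -natrM [in RHS]mulnA -sum_deg // big_distrl /=.
  congr _%:R; apply: eq_bigr => x _.
  rewrite mul0n add0n mul1n nonloop_number_card; congr (_ * antichain_count _ _)%N.
  move: (loopless_deg_gt0 x) (loopless_deg_lt x); move: (deg M x) #|E| => b n; lia.
- rewrite coef_F_matroid_gt ?loops0 // mulr0 big1 // => x _.
  by rewrite !mul0n muln0.
Qed.

(** A vertex of degree b contributes at [[::]] only if the antichain left over is empty, while the
    binomials require c <= |E| - b - 1 and d <= b - 1. So both are equalities, that is, b = d + 1
    and |E| = c + d + 2. *)
Lemma newton_newton_F_matroid c d :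
  newton d (newton c (F_matroid M)) [::] =
  (-1) ^+ (c + d) *
    ((c + d.+2 == #|E|) * (#|[set x | deg M x == d.+1]| * d.+1))%N%:R.
Proof.
rewrite newton_F_matroid newton_linear.
under eq_bigr => x _ do rewrite newton_star /= muln0 mulr0 add0r.
have -> : ((c + d.+2 == #|E|) * (#|[set x | deg M x == d.+1]| * d.+1))%N =
    (\sum_(x | deg M x == d.+1) (c + d.+2 == #|E|) * d.+1)%N.
  by rewrite sum_nat_const cardsE; lia.
rewrite natr_sum mulr_sumr [RHS]big_mkcond /=; apply: eq_bigr => x _.
move: (loopless_deg_gt0 x) (loopless_deg_lt x); move: (deg M x) #|E| => b n b0 bn.
rewrite mulrACA -exprD -natrM.
have [cb|cb] := ltnP (n - b - 1)%N c.
  rewrite bin_small // !mul0n mulr0; have [bd|//] := eqVneq b d.+1.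
  by rewrite (_ : (_ == _) = false) ?mul0n ?mulr0 //; lia.
have [db|db] := ltnP b.-1 d.
  by rewrite ['C(b.-1, d)]bin_small // mul0n muln0 mulr0 ifF //; lia.
have [bd|bd] := eqVneq b d.+1.
  congr (_ * _%:R); subst b => /=.
  have [e|ne] := eqVneq (c + d.+2)%N n.
    have -> : (n - d.+1 - 1 = c)%N by lia.
    by rewrite !binn subnn add0n subnn eqxx; lia.
  rewrite (_ : (_ == 0)%N = false) ?muln0 ?mul0n //; lia.
by rewrite (_ : (_ == 0)%N = false) ?muln0 ?mulr0 //; lia.
Qed.

End NewtonMatroid.

(** * Recognizing isomorphic rank two matroids *)

Section ClassBijection.
Local Open Scope nat_scope.
Variables (T1 T2 : finType) (K1 K2 : eqType) (k1 : T1 -> K1) (k2 : T2 -> K2).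
Variables (w1 : K1 -> nat) (w2 : K2 -> nat) (c : nat -> nat) (f0 : T1 -> T2).
Hypothesis card_class1 : forall x, #|[set z | k1 z == k1 x]| = c (w1 (k1 x)).
Hypothesis card_class2 : forall y, #|[set z | k2 z == k2 y]| = c (w2 (k2 y)).

(** Greedy matching: a class in [D1] is paired with one of the same weight in [D2]. Their sizes
    agree, both being [c] of the weight, and after removing the two the counts by weight still
    agree. *)
Lemma class_bijection_in (D1 : {set T1}) (D2 : {set T2}) :
  (forall x z, x \in D1 -> k1 z = k1 x -> z \in D1) ->
  (forall y z, y \in D2 -> k2 z = k2 y -> z \in D2) ->
  (forall b, #|[set x in D1 | w1 (k1 x) == b]| = #|[set y in D2 | w2 (k2 y) == b]|) ->
  exists f : T1 -> T2,
    [/\ f @: D1 = D2, {in D1 &, injective f}, {in D1, forall x, w2 (k2 (f x)) = w1 (k1 x)}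
      & {in D1 &, forall x z, (k2 (f x) == k2 (f z)) = (k1 x == k1 z)}].
Proof.
move: {2}#|D1| (leqnn #|D1|) => n; elim: n D1 D2 => [|n IH] D1 D2.
  rewrite leqn0 cards_eq0 => /eqP-> _ sat2 eqD; exists f0.
  split; try by move=> x; rewrite inE.
  rewrite imset0; apply/esym/setP => y; rewrite inE; apply/negP => yD.
  have := eqD (w2 (k2 y)); rewrite [X in #|pred_of_set X|](_ : _ = set0); last first.
    by apply/setP => z; rewrite !inE.
  by rewrite cards0 => /esym/eqP; rewrite cards_eq0 => /eqP/setP/(_ y); rewrite !inE yD eqxx.
move=> D1n sat1 sat2 eqD.
have [D10|[x xD]] := set_0Vmem D1.
  by apply: IH; rewrite // D10 cards0.
have [y] : exists y, y \in [set y in D2 | w2 (k2 y) == w1 (k1 x)].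
  apply/card_gt0P; rewrite -eqD card_gt0; apply/set0Pn; exists x.
  by rewrite inE xD eqxx.
rewrite inE => /andP[yD /eqP wyx].
set C1 := [set z | k1 z == k1 x]; set C2 := [set z | k2 z == k2 y].
have cC : #|C1| = #|C2| by rewrite card_class1 card_class2 wyx.
have sC1 : C1 \subset D1 by apply/subsetP => z; rewrite inE => /eqP; apply: sat1.
have sC2 : C2 \subset D2 by apply/subsetP => z; rewrite inE => /eqP; apply: sat2.
have [|||b|f [fD finj fw fk]] := IH (D1 :\: C1) (D2 :\: C2).
- rewrite -ltnS; apply: leq_trans D1n; apply: proper_card; apply/properP.
  by split; [apply: subsetDl | exists x; rewrite // !inE eqxx].
- move=> z z'; rewrite !inE => /andP[zC zD] zz'.
  by rewrite zz' zC (sat1 z).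
- move=> z z'; rewrite !inE => /andP[zC zD] zz'.
  by rewrite zz' zC (sat2 z).
- have e1 : [set z in D1 :\: C1 | w1 (k1 z) == b] =
      [set z in D1 | w1 (k1 z) == b] :\: C1.
    by apply/setP => z; rewrite !inE andbA.
  have e2 : [set z in D2 :\: C2 | w2 (k2 z) == b] =
      [set z in D2 | w2 (k2 z) == b] :\: C2.
    by apply/setP => z; rewrite !inE andbA.
  rewrite e1 e2; have [->|bx] := eqVneq b (w1 (k1 x)).
    rewrite !cardsDS; first by rewrite eqD cC.
      apply/subsetP => z zC; rewrite inE (subsetP sC2) //=.
      by move: zC; rewrite inE => /eqP->; rewrite wyx.
    apply/subsetP => z zC; rewrite inE (subsetP sC1) //=.
    by move: zC; rewrite inE => /eqP->.
  have -> : [set z in D1 | w1 (k1 z) == b] :\: C1 = [set z in D1 | w1 (k1 z) == b].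
    apply/setP => z; rewrite !inE; case: eqP => //= ->.
    by rewrite eq_sym (negPf bx) andbF.
  have -> : [set z in D2 | w2 (k2 z) == b] :\: C2 = [set z in D2 | w2 (k2 z) == b].
    apply/setP => z; rewrite !inE; case: eqP => //= ->.
    by rewrite wyx eq_sym (negPf bx) andbF.
  exact: eqD.
pose g z := nth y (enum C2) (index z (enum C1)).
have gE z : z \in C1 -> index z (enum C1) < size (enum C2).
  by move=> zC; rewrite -cardE -cC cardE index_mem mem_enum.
have gC z : z \in C1 -> g z \in C2.
  by move=> zC; rewrite -mem_enum mem_nth // gE.
pose h z := if z \in C1 then g z else f z.
have fC z : z \in D1 -> z \notin C1 -> f z \in D2 :\: C2.
  by move=> zD zC; rewrite -fD imset_f // inE zC.
have kC1 z z' : z \in C1 -> (k1 z == k1 z') = (z' \in C1).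
  by rewrite !inE => /eqP->; rewrite eq_sym.
have kC2 z z' : z \in C2 -> (k2 z == k2 z') = (z' \in C2).
  by rewrite !inE => /eqP->; rewrite eq_sym.
have hC z : z \in D1 -> (h z \in C2) = (z \in C1).
  move=> zD; rewrite /h; case: ifP => zC; first exact: gC.
  by have := fC z zD (negbT zC); rewrite inE => /andP[/negPf].
exists h; split.
- apply/setP => z; apply/imsetP/idP => [[u uD ->]|zD].
    rewrite /h; case: ifP => uC; first by apply: (subsetP sC2); apply: gC.
    by have := fC u uD (negbT uC); rewrite inE => /andP[].
  have [zC|zC] := boolP (z \in C2).
    have lz : index z (enum C2) < size (enum C1).
      by rewrite -cardE cC cardE index_mem mem_enum.
    have uC : nth x (enum C1) (index z (enum C2)) \in C1.
      by rewrite -mem_enum mem_nth.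
    exists (nth x (enum C1) (index z (enum C2))); first exact: (subsetP sC1).
    by rewrite /h uC /g index_uniq ?enum_uniq // nth_index // mem_enum.
  have : z \in D2 :\: C2 by rewrite inE zC.
  rewrite -fD => /imsetP[u]; rewrite inE => /andP[uC uD] ->.
  by exists u; rewrite // /h (negPf uC).
- move=> u v uD vD huv; have := hC u uD; rewrite huv hC // => uvC.
  move: huv; rewrite /h uvC; case: ifP => uC; last first.
    by apply: finj; rewrite inE ?uvC uC.
  have vC : v \in C1 by rewrite uvC.
  move/eqP; rewrite nth_uniq ?gE ?enum_uniq // => /eqP iuv.
  have uE : u \in enum C1 by rewrite mem_enum.
  have vE : v \in enum C1 by rewrite mem_enum.
  by rewrite -(nth_index x uE) iuv nth_index.
- move=> u uD; rewrite /h; case: ifP => uC; last by rewrite fw // inE uC.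
  have := gC u uC; rewrite inE => /eqP->; move: uC; rewrite inE => /eqP->.
  exact: wyx.
move=> u v uD vD; have [uC|uC] := boolP (u \in C1).
  by rewrite kC1 // kC2 ?hC // .
have [vC|vC] := boolP (v \in C1).
  by rewrite eq_sym kC2 ?hC // [RHS]eq_sym kC1.
by rewrite /h (negPf uC) (negPf vC) fk // inE ?uC ?vC.
Qed.

Lemma class_bijection :
  (forall b, #|[set x | w1 (k1 x) == b]| = #|[set y | w2 (k2 y) == b]|) ->
  exists f : T1 -> T2,
    [/\ bijective f, forall x, w2 (k2 (f x)) = w1 (k1 x)
      & forall x z, (k2 (f x) == k2 (f z)) = (k1 x == k1 z)].
Proof.
move=> eqD; have [//|//||f [fD finj fw fk]] := @class_bijection_in setT setT.
  move=> b; rewrite [X in #|pred_of_set X| = _](_ : _ = [set x | w1 (k1 x) == b]).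
    by rewrite eqD; apply: eq_card => y; rewrite !inE.
  by apply/setP => z; rewrite !inE.
exists f; split=> [|x|x z]; try by [apply: fw | apply: fk].
apply: inj_card_bij => [x z|]; first by apply: finj.
by rewrite -(cardsT T1) -(cardsT T2) -fD leq_imset_card.
Qed.

End ClassBijection.

Section RankTwoIsomorphism.
Local Open Scope nat_scope.

(** The loops form one class, and the class of a nonloop is the complement of its neighbourhood
    among the nonloops. So within [M] the degree fixes the size. *)
Lemma card_nbhd_class (E : finType) (M : matroid E) x : rank M = 2 ->
  #|[set z | nbhd M z == nbhd M x]| =
  if deg M x == 0 then #|loops M| else nonloop_number M - deg M x.
Proof.
move=> rM; case: ifPn => [|]; rewrite -?lt0n ?deg_gt0 // => xl.
  apply: eq_card => z; move: xl; rewrite cards_eq0 !inE => /eqP->.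
  by [].
rewrite -card_nonloops /deg -cardsDS; last first.
  apply/subsetP => y; rewrite inE => xy; rewrite inE.
  by apply: (@adj_loops _ _ _ x); rewrite adjC.
apply: eq_card => z; rewrite [LHS]inE [RHS]inE [z \in ~: _]inE inE.
apply/eqP/andP => [zx|[nxz zl]]; last first.
  by apply/esym/nonadj_nbhd.
by split; [rewrite adjE // zx eqxx | move: xl; rewrite !inE zx].
Qed.

(** The bound [n] is free so that the sums of two matroids can run over the same range. *)
Lemma sum_by_deg (E : finType) (M : matroid E) (h : nat -> nat) n : #|E| <= n ->
  \sum_x h (deg M x) = \sum_(b < n.+1) #|[set x | deg M x == b]| * h b.
Proof.
move=> En; have dn x : deg M x < n.+1 by rewrite ltnS (leq_trans (max_card _)).
rewrite (partition_big (fun x => inord (deg M x) : 'I_n.+1) predT) //=.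
apply: eq_bigr => b _; rewrite -sum_nat_const.
apply: eq_big => x; first by rewrite !inE -val_eqE /= inordK.
by move/eqP <-; rewrite inordK.
Qed.

(** Parallel classes are matched by degree, which fixes their sizes. The resulting bijection
    respects loops and equality of neighbourhoods, hence adjacency by [adjE]. *)
Lemma rank2_iso (E1 E2 : finType) (M1 : matroid E1) (M2 : matroid E2) :
  rank M1 = 2 -> rank M2 = 2 ->
  (forall b, #|[set x | deg M1 x == b]| = #|[set x | deg M2 x == b]|) ->
  matroid_iso M1 M2.
Proof.
move=> r1 r2 eqd.
have eql : #|loops M1| = #|loops M2|.
  have lE (E : finType) (M : matroid E) : loops M = [set x | deg M x == 0].
    by apply/setP => x; rewrite !inE cards_eq0.
  by rewrite !lE.
have eqE : #|E1| = #|E2|.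
  have [n [le1 le2]] : exists n, #|E1| <= n /\ #|E2| <= n.
    by exists (#|E1| + #|E2|); rewrite leq_addr leq_addl.
  have := sum_by_deg M2 (fun=> 1) le2; rewrite sum1_card => ->.
  have := sum_by_deg M1 (fun=> 1) le1; rewrite sum1_card => ->.
  by apply: eq_bigr => b _; rewrite eqd.
have eqN : nonloop_number M1 = nonloop_number M2 by rewrite /nonloop_number eql eqE.
have [y0 _] : exists y, y \in [set: E2].
  have /card_gt0P[B /(basis_pair r2)[y _]] := card_bases_gt0 M2.
  by exists y; rewrite inE.
pose c b := if b == 0 then #|loops M2| else nonloop_number M2 - b.
have [|x|f [bf fd fk]] := @class_bijection _ _ _ _ (nbhd M1) (nbhd M2)
  (fun A => #|A|) (fun A => #|A|) c (fun=> y0) _ _ eqd.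
- by move=> x; rewrite card_nbhd_class // eql eqN.
- exact: card_nbhd_class.
have floops x : (f x \in loops M2) = (x \in loops M1).
  by rewrite !inE -!cards_eq0 fd.
have fadj x y : adj M2 (f x) (f y) = adj M1 x y.
  by rewrite !adjE // fk !floops.
have [g fK gK] := bf.
exists f => // B; apply/idP/idP => hB.
  have [u [v [uv Buv]]] := basis_pair r2 hB.
  rewrite -(gK u) -(gK v) fadj in uv.
  rewrite (_ : f @^-1: B = [set g u; g v]) //.
  by apply/setP => z; rewrite Buv !inE !(can2_eq fK gK).
have [u [v [uv Buv]]] := basis_pair r1 hB.
rewrite (_ : B = [set f u; f v]) -?/(adj _ _ _) ?fadj //.
apply/setP => z; have /setP/(_ (g z)) := Buv; rewrite !inE gK => ->.
by rewrite !(can2_eq gK fK).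
Qed.

End RankTwoIsomorphism.

(** * Degrees from F, and from F modulo the square of the maximal ideal *)

Section Determination.
Local Open Scope nat_scope.

Local Notation degrees M b := #|[set x | deg M x == b]|.

Lemma antichain_count1 t s : antichain_count t [:: s] = (s == t).
Proof.
rewrite /=; case: (ltngtP s t) => [st|ts|->]; last by rewrite binn subnn.
  by rewrite subn_eq0 leqNgt st muln0.
by rewrite bin_small.
Qed.

Lemma degrees_0 (E : finType) (M : matroid E) : degrees M 0 = #|loops M|.
Proof. by apply: eq_card => x; rewrite !inE cards_eq0. Qed.

Lemma degrees_ge (E : finType) (M : matroid E) b : rank M = 2 ->
  0 < b -> nonloop_number M <= b -> degrees M b = 0.
Proof.
move=> r b0 Nb; apply/eqP; rewrite cards_eq0; apply/set0Pn => -[x].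
rewrite inE => /eqP xb; have := deg_lt r (x := x).
by rewrite -deg_gt0 xb b0 ltnNge Nb => /(_ isT).
Qed.

Lemma nonloop_number_ge2 (E : finType) (M : matroid E) : rank M = 2 ->
  2 <= nonloop_number M.
Proof.
move=> r; have /card_gt0P[B /(basis_pair r)[x [y [xy _]]]] := card_bases_gt0 M.
have xl := adj_loops xy; apply: leq_ltn_trans (deg_lt r xl).
by rewrite deg_gt0.
Qed.

Section SameF.
Variables (E1 E2 : finType) (M1 : matroid E1) (M2 : matroid E2).
Hypotheses (r1 : rank M1 = 2) (r2 : rank M2 = 2).

(** With first exponent [#|loops M2|.+2] and all the other elements in the second entry, the
    coefficient of [M2] is its number of bases; a matroid with fewer loops has coefficient 0
    there. *)
Lemma F_matroid_loops_le :
  F_matroid M1 =1 F_matroid M2 -> #|loops M2| <= #|loops M1|.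
Proof.
move=> FF; rewrite leqNgt; apply/negP => ll.
have := coef_F_matroid_2 r2 [:: nonloop_number M2 - 2].
rewrite -FF coef_F_matroid_gt // antichain_count1 eqxx muln1 => /esym/eqP.
by rewrite Num.Theory.pnatr_eq0 -leqn0 leqNgt card_bases_gt0.
Qed.

End SameF.

Lemma F_matroid_degrees (E1 E2 : finType) (M1 : matroid E1) (M2 : matroid E2) :
  rank M1 = 2 -> rank M2 = 2 -> F_matroid M1 =1 F_matroid M2 ->
  forall b, degrees M1 b = degrees M2 b.
Proof.
move=> r1 r2 FF.
have natR_inj (m n : nat) : (m%:R = n%:R :> rat)%R -> m = n.
  by move/eqP; rewrite Num.Theory.eqr_nat => /eqP.
have eql : #|loops M1| = #|loops M2|.
  by apply/eqP; rewrite eqn_leq !F_matroid_loops_le // => e; rewrite FF.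
have N1 := nonloop_number_ge2 r1; have N2 := nonloop_number_ge2 r2.
have eqb e : #|bases M1| * antichain_count (nonloop_number M1 - 2) e =
             #|bases M2| * antichain_count (nonloop_number M2 - 2) e.
  by apply: natR_inj; rewrite -!coef_F_matroid_2 // FF eql.
have eqN : nonloop_number M1 = nonloop_number M2.
  have := eqb [:: nonloop_number M1 - 2]; rewrite !antichain_count1 eqxx muln1.
  case: eqP => [|_]; first by lia.
  by rewrite muln0 => /eqP; rewrite -leqn0 leqNgt card_bases_gt0.
have eqB : #|bases M1| = #|bases M2|.
  have := eqb [:: nonloop_number M1 - 2].
  by rewrite !antichain_count1 -eqN eqxx !muln1.
have eqS e : \sum_x deg M1 x * star_term M1 e x = \sum_x deg M2 x * star_term M2 e x.
  have /natR_inj : ((\sum_x deg M1 x * star_term M1 e x +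
      #|bases M1| * (#|loops M1| * antichain_count (nonloop_number M1 - 1) e))%N%:R =
    (\sum_x deg M2 x * star_term M2 e x +
      #|bases M2| * (#|loops M2| * antichain_count (nonloop_number M2 - 1) e))%N%:R :> rat)%R.
    by rewrite -!coef_F_matroid_1 // FF eql.
  by rewrite eqB eql eqN => /addIn.
elim/ltn_ind => b IH; have [->|b0] := posnP b; first by rewrite !degrees_0.
have [Nb|bN] := leqP (nonloop_number M2) b.
  by rewrite !degrees_ge // eqN.
have [i Ni] : exists i, nonloop_number M2 = b + i.+1.
  by exists (nonloop_number M2 - b - 1); lia.
(* Let N be the number of nonloops. The star behind [h c] has N - c minimal elements, and [e] asks
   for a first fiber of i + 1 = N - b of them: impossible for c > b, and possible in one way for c =
   b, leaving an antichain of b - 1 elements. So the system is triangular. *)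
pose e := [:: i.+1; b.-1]; pose n := #|E1| + #|E2|.
pose h c := c * star_count (nonloop_number M2 - c - 1) c.-1 e.
have h0 c : b < c -> c < nonloop_number M2 -> h c = 0.
  move=> bc cN; have ci : nonloop_number M2 - c - 1 < i by lia.
  rewrite /h /e; cbn [star_count]; rewrite [X in c * (X * _ + _)]bin_small ?(leqW ci) //.
  by rewrite [X in c * (_ + X * _)]bin_small // !mul0n muln0.
have hb : h b = b.
  rewrite /h (_ : _ - 1 = i); last by lia.
  rewrite /e; cbn [star_count]; rewrite bin_small // mul0n add0n binn mul1n subnn.
  by rewrite add0n antichain_count1 eqxx muln1.
have := eqS e; rewrite /star_term eqN.
rewrite (@sum_by_deg _ M1 h n) ?leq_addr // (@sum_by_deg _ M2 h n) ?leq_addl //.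
have bn : b < n.+1.
  rewrite ltnS; apply: leq_trans (ltnW bN) _.
  by rewrite /nonloop_number; apply: leq_trans (leq_subr _ _) _; rewrite leq_addl.
rewrite (bigD1 (Ordinal bn)) //= [RHS](bigD1 (Ordinal bn)) //= hb => /eqP.
rewrite (eq_bigr (fun c : 'I_n.+1 => degrees M2 c * h c)).
  by rewrite eqn_add2r eqn_pmul2r // => /eqP.
move=> c; rewrite -val_eqE /= => cb; have [lt_cb|] := ltnP c b; first by rewrite IH.
rewrite leq_eqVlt eq_sym (negPf cb) /= => bc.
have [Nc|cN] := leqP (nonloop_number M2) c; last by rewrite h0 // !muln0.
by rewrite !degrees_ge // ?eqN //; lia.
Qed.

End Determination.

(** * Connected matroids of rank two *)

Section Connected.
Local Open Scope nat_scope.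

(** Recombination of bases along [A] expresses, through bases alone, that [M] is the direct sum of
    its restrictions to [A] and to the complement. *)
Definition separates (E : finType) (M : matroid E) (A : {set E}) :=
  forall B B', B \in bases M -> B' \in bases M -> (B :&: A) :|: (B' :\: A) \in bases M.

Section Restriction.
Variables (E : finType) (M : matroid E) (A : {set E}).
Hypothesis sepA : separates M A.

Lemma restriction_subproof :
  is_bases [set (val : {x | x \in A} -> E) @^-1: B | B : {set E} in bases M].
Proof.
apply/is_basesP; split.
  have /is_basesP[/set0Pn[B hB] _] := valP M.
  by apply/set0Pn; exists (val @^-1: B); apply: imset_f.
move=> _ _ /imsetP[B1 h1 ->] /imsetP[B2 h2 ->] x; rewrite !inE => /andP[x2 x1].
have xA := valP x.
(* The second basis agrees with [B1] outside [A], so the element exchanged in has to lie in [A]. *)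
have [||y [y3 y1 hy]] := bases_exchange (x := val x) h1 (sepA h2 h1).
- exact: x1.
- by rewrite !inE (negPf x2) xA.
have yA : y \in A.
  by move: y3; rewrite !inE (negPf y1) andbF orbF => /andP[].
move: y3; rewrite !inE yA /= andbT orbF => y2.
exists (exist _ y yA); first by rewrite !inE y1 y2.
apply/imsetP; exists (y |: B1 :\ val x) => //.
by apply/setP => z; rewrite !inE -!val_eqE.
Qed.

Definition restriction : matroid {x | x \in A} := Matroid restriction_subproof.

End Restriction.

Lemma separatesC (E : finType) (M : matroid E) (A : {set E}) :
  separates M A -> separates M (~: A).
Proof.
move=> sepA B B' hB hB'; rewrite setDE setCK setUC.
by have := sepA B' B hB' hB; rewrite setDE.
Qed.

Lemma connected_separates (E : finType) (M : matroid E) (A : {set E}) :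
  connected M -> separates M A -> A = set0 \/ A = setT.
Proof.
move=> [_ conn] sepA; have sepC := separatesC sepA.
have iso : matroid_iso (dsum (restriction sepA) (restriction sepC)) M.
  pose g (s : {x | x \in A} + {x | x \in ~: A}) :=
    match s with inl u => val u | inr v => val v end.
  exists g => [|B].
    apply: inj_card_bij => [[u|u] [v|v] /= uv|].
    - by rewrite (val_inj uv).
    - have uA : sval u \in A := valP u; have vA : sval v \in ~: A := valP v.
      by move: vA; rewrite -uv inE uA.
    - have uA : sval u \in ~: A := valP u; have vA : sval v \in A := valP v.
      by move: uA; rewrite uv inE vA.
    - by rewrite (val_inj uv).
    by rewrite card_sum !card_sig -(cardsC A) leq_add //; apply: eq_leq; apply: eq_card.
  rewrite inE; apply/idP/andP => [hB|[/imsetP[B1 h1 e1] /imsetP[B2 h2 e2]]].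
    split; apply/imsetP; exists B => //; apply/setP => z; by rewrite !inE.
  suff -> : B = (B1 :&: A) :|: (B2 :\: A) by apply: sepA.
  apply/setP => z; rewrite !inE; have [zA|zA] := boolP (z \in A).
    by rewrite andbT orbF; have /setP/(_ (exist _ z zA)) := e1; rewrite !inE.
  rewrite andbF /=; have zC : z \in ~: A by rewrite inE.
  by have /setP/(_ (exist _ z zC)) := e2; rewrite !inE.
have [c|c] := conn _ _ _ _ (iso_sym iso); [left|right]; apply/setP => z; rewrite !inE.
  by apply/negP => zA; have := fintype0 (exist _ z zA) c.
apply/negPn/negP => zA; have zC : z \in ~: A by rewrite inE.
by have := fintype0 (exist _ z zC : {x | x \in ~: A}) c.
Qed.

Variables (E : finType) (M : matroid E).
Hypotheses (rank2 : rank M = 2) (connM : connected M).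

Lemma connected_loopless : loops M = set0.
Proof.
apply/setP => z; rewrite [RHS]inE; apply/negP => zl.
have zB B : B \in bases M -> z \notin B.
  move=> /(basis_pair rank2)[x [y [xy ->]]]; have yx := xy; rewrite adjC in yx.
  rewrite !inE negb_or; apply/andP.
  by split; apply: contraTneq zl => ->; apply: adj_loops; eassumption.
have [|/setP/(_ z)|zT] := connected_separates (A := [set z]) connM.
- move=> B B' hB hB'; rewrite (_ : _ :|: _ = B') //; apply/setP => x; rewrite !inE.
  have [->|_] := eqVneq x z; first by rewrite (negPf (zB B hB)) (negPf (zB B' hB')).
  by rewrite andbF.
- by rewrite !inE eqxx.
have /card_gt0P[B hB] := card_bases_gt0 M.
have /set0Pn[x xB] : B != set0 by rewrite -cards_eq0 (card_basis2 rank2 hB).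
move/setP/(_ x): zT; rewrite !inE => /eqP xz.
by move: xB; rewrite xz (negPf (zB B hB)).
Qed.

(** The neighbourhoods of [x] and [y] cover E. If their sizes add up to at most |E|, they are
    disjoint, so there are only two parallel classes, the bases are the transversals, and one class
    separates [M]. *)
Lemma connected_deg x y : adj M x y -> #|E| < deg M x + deg M y.
Proof.
move=> xy; rewrite ltnNge; apply/negP => dxy.
have nl z : z \notin loops M by rewrite connected_loopless inE.
have cov : nbhd M x :|: nbhd M y = setT.
  apply/setP => z; rewrite !inE; have /nonloopP[w zw] := nl z.
  by have := adj_trans rank2 xy zw; rewrite !(adjC M z).
have dis z : adj M x z -> ~~ adj M y z.
  move=> xz; apply/negP => yz.
  have : z \in nbhd M x :&: nbhd M y by rewrite !inE xz.
  rewrite (_ : _ :&: _ = set0) ?inE //; apply/eqP; rewrite -cards_eq0 cardsI cov cardsT.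
  by rewrite subn_eq0.
have [nxy _ _] : [/\ nbhd M x != nbhd M y, x \notin loops M & y \notin loops M].
  by apply/and3P; rewrite -adjE.
pose A := [set z | nbhd M z == nbhd M y].
have zA z : z \notin A -> nbhd M z = nbhd M x.
  rewrite inE => zy; have /setP/(_ z) := cov; rewrite !inE => /orP[xz|yz].
    by case/negP: zy; apply/eqP/esym/nonadj_nbhd => //; apply: dis.
  by apply/esym/nonadj_nbhd => //; apply/negP => /dis; rewrite yz.
have adjA u v : u \in A -> v \notin A -> adj M u v.
  move=> uA vA; rewrite adjE // !nl !andbT (zA v vA) eq_sym.
  by move: uA; rewrite inE => /eqP->.
have basA B : B \in bases M -> exists u v, [/\ u \in A, v \notin A & B = [set u; v]].
  move=> /(basis_pair rank2)[u [v [+ ->]]]; rewrite adjE // => /and3P[uv _ _].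
  have [uA|uA] := boolP (u \in A); have [vA|vA] := boolP (v \in A).
  - by move: uA vA uv; rewrite !inE => /eqP-> /eqP->; rewrite eqxx.
  - by exists u, v.
  - by exists v, u; split=> //; rewrite setUC.
  - by move: uv; rewrite (zA u) // (zA v) // eqxx.
have [|/setP/(_ y)|/setP/(_ x)] := connected_separates (A := A) connM.
- move=> B B' /basA[u [v [uA vA ->]]] /basA[u' [v' [uA' vA' ->]]].
  rewrite (_ : _ :|: _ = [set u; v']); first exact: adjA.
  apply/setP => z; rewrite in_setU in_setI in_setD !in_set2.
  have neq (w w' : E) : (w \in A) != (w' \in A) -> (w == w') = false.
    by apply: contraNF => /eqP->.
  have [Az|Az] := boolP (z \in A).
    by rewrite /= andbT orbF (neq z v) ?(neq z v') ?Az ?(negPf vA) ?(negPf vA').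
  by rewrite /= andbF (neq z u') ?(neq z u) ?(negPf Az) ?uA ?uA'.
- by rewrite !inE eqxx.
by rewrite !inE (negPf nxy).
Qed.

End Connected.

(** * Degree counts of connected matroids from the brackets *)

Section Main.
Local Open Scope nat_scope.
Local Notation degrees M b := #|[set x | deg M x == b]|.

Section Bracket.
Variables (E : finType) (M : matroid E).
Hypotheses (rank2 : rank M = 2) (connM : connected M).

Lemma connected_degrees_0 : degrees M 0 = 0.
Proof. by rewrite degrees_0 connected_loopless // cards0. Qed.

Lemma connected_degrees_ge b : #|E| <= b -> degrees M b = 0.
Proof.
have [->|b0] := posnP b; first by rewrite connected_degrees_0.
by rewrite -(@nonloop_number_card _ M) ?connected_loopless // => /degrees_ge ->.
Qed.

Lemma connected_degrees_mul c d : c + d = #|E| -> c != d ->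
  degrees M c * degrees M d = 0.
Proof.
move=> cdE cd; apply/eqP; rewrite muln_eq0 -implyNb -lt0n; apply/implyP => /card_gt0P[x].
rewrite inE => /eqP xc; rewrite cards_eq0; apply/set0Pn => -[y]; rewrite inE => /eqP yd.
have xy : adj M x y.
  rewrite adjE // !connected_loopless // !inE !andbT; apply: contraNneq cd => nxy.
  by rewrite -xc -yd /deg nxy.
by have := connected_deg rank2 connM xy; rewrite xc yd cdE ltnn.
Qed.

(** A degree above |E| / 2 differs from its complement in |E|, so the bracket for this pair is
    nonzero; this is how [card_ground_eq] reads off the size of the ground set. *)
Lemma connected_deg_large : exists x, #|E| < deg M x + deg M x.
Proof.
have /card_gt0P[B /(basis_pair rank2)[x [y [xy _]]]] := card_bases_gt0 M.
have := connected_deg rank2 connM xy.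
have [le|/ltnW le] := leqP (deg M x) (deg M y) => h.
  by exists y; apply: leq_trans h _; rewrite leq_add2r.
by exists x; apply: leq_trans h _; rewrite leq_add2l.
Qed.

Lemma newton_bracket_F_matroid c d :
  newton_bracket c d (F_matroid M) =
  ((-1) ^+ (c + d) * (((c + d.+2 == #|E|) * (degrees M d.+1 * d.+1))%N%:R -
    ((c + d.+2 == #|E|) * (degrees M c.+1 * c.+1))%N%:R))%R.
Proof.
rewrite /newton_bracket !newton_newton_F_matroid ?connected_loopless //.
by rewrite [d + c]addnC -mulrBr [d + c.+2]addnC addSnnS -addSnnS addnS.
Qed.

End Bracket.

Section Compare.
Variables (E1 E2 : finType) (M1 : matroid E1) (M2 : matroid E2).
Hypotheses (r1 : rank M1 = 2) (r2 : rank M2 = 2).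
Hypotheses (c1 : connected M1) (c2 : connected M2).
Hypothesis eqF : forall c d,
  newton_bracket c d (F_matroid M1) = newton_bracket c d (F_matroid M2).

(** Here [c] and [d] are degrees, one more than the indices of the bracket. Negative terms are moved
    across to stay in the natural numbers. *)
Lemma bracket_balance c d : 0 < c -> 0 < d ->
  (c + d == #|E1|) * (degrees M1 d * d) + (c + d == #|E2|) * (degrees M2 c * c) =
  (c + d == #|E2|) * (degrees M2 d * d) + (c + d == #|E1|) * (degrees M1 c * c).
Proof.
case: c => // c _; case: d => // d _.
have := eqF c d; rewrite !newton_bracket_F_matroid // !addnS addSn.
have sgn : ((-1) ^+ (c + d) != 0 :> rat)%R by rewrite signr_eq0.
move=> /(mulfI sgn)/eqP; rewrite subr_eq addrAC eq_sym subr_eq -!natrD.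
by rewrite Num.Theory.eqr_nat eq_sym => /eqP.
Qed.

Lemma card_ground_eq : #|E1| = #|E2|.
Proof.
have [x xl] := connected_deg_large r1 c1.
have xn : deg M1 x < #|E1| by apply: loopless_deg_lt; rewrite ?connected_loopless.
have x0 : 0 < deg M1 x by apply: loopless_deg_gt0; rewrite ?connected_loopless.
have [c Ec] : exists c, c + deg M1 x = #|E1| by exists (#|E1| - deg M1 x); lia.
have cx : c != deg M1 x by lia.
have bx : 0 < degrees M1 (deg M1 x) by apply/card_gt0P; exists x; rewrite inE.
have := connected_degrees_mul r1 c1 Ec cx => /eqP.
rewrite muln_eq0 [X in _ || X]eqn0Ngt bx orbF => /eqP dc.
have c0 : 0 < c by lia.
(* If the sizes of the ground sets differed, both terms of [M2] would vanish, while that of [M1] for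
   the degree of [x] is positive. *)
have := bracket_balance c0 x0; rewrite Ec eqxx dc !mul1n mul0n addn0.
by case: eqP => // _; nia.
Qed.

End Compare.

Lemma F_matroid_bracket_degrees (E1 E2 : finType) (M1 : matroid E1) (M2 : matroid E2) :
  rank M1 = 2 -> rank M2 = 2 -> connected M1 -> connected M2 ->
  (forall c d, newton_bracket c d (F_matroid M1) = newton_bracket c d (F_matroid M2)) ->
  forall b, degrees M1 b = degrees M2 b.
Proof.
move=> r1 r2 c1 c2 eqF; have eqE := card_ground_eq r1 r2 c1 c2 eqF.
have off b : b + b != #|E2| -> degrees M1 b = degrees M2 b.
  move=> bE; have [->|b0] := posnP b; first by rewrite !connected_degrees_0.
  have [Eb|bE2] := leqP #|E2| b; first by rewrite !connected_degrees_ge // eqE.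
  have [d Ed] : exists d, b + d = #|E2| by exists (#|E2| - b); lia.
  have bd : b != d by apply: contraNneq bE => bd; rewrite {2}bd Ed.
  have d0 : 0 < d by lia.
  (* For each matroid at most one of the terms for [b] and [d] is nonzero, so the sign and size of
     their difference give both counts. *)
  have := bracket_balance r1 r2 c1 c2 eqF b0 d0.
  rewrite eqE Ed eqxx !mul1n.
  have := connected_degrees_mul r1 c1 (etrans Ed (esym eqE)) bd.
  have := connected_degrees_mul r2 c2 Ed bd.
  move: (degrees M1 b) (degrees M1 d) (degrees M2 b) (degrees M2 d) => m1 m1' m2 m2'.
  by nia.
(* The bracket of equal indices is zero and says nothing about b = |E| / 2; that count is what the
   others leave of |E|. *)
move=> b; have [bE|] := eqVneq (b + b) #|E2|; last exact: off.
have le1 : #|E1| <= #|E2| by rewrite eqE.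
have := sum_by_deg M2 (fun=> 1) (leqnn #|E2|); have := sum_by_deg M1 (fun=> 1) le1.
rewrite !sum1_card eqE => A1 A2; have := etrans (esym A1) A2.
have bn : b < #|E2|.+1 by rewrite -bE ltnS leq_addr.
rewrite (bigD1 (Ordinal bn)) //= [RHS](bigD1 (Ordinal bn)) //= !muln1.
rewrite (eq_bigr (fun c : 'I_#|E2|.+1 => degrees M2 c * 1)) => [/addIn //|c].
by rewrite -val_eqE /= => cb; rewrite off // -[X in _ != X]bE !addnn (inj_eq double_inj).
Qed.

Lemma rep_iso_eq (x y : mclass) : matroid_iso (rep x) (rep y) -> x = y.
Proof. by move/class_ofP; rewrite !class_of_rep. Qed.

End Main.

Theorem proposition6p6 :
  {in rank2_classes &, injective F_Mat} /\
  {in connected_rank2_classes &, injective Fbar}.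
Proof.
split=> x y /set_mem + /set_mem.
  move=> [c rc xc] [d rd yd] FF.
  rewrite -xc -yd; suff -> : c = d by exact: erefl.
  apply/rep_iso_eq/rank2_iso => //; apply: F_matroid_degrees => // e.
  by rewrite -!F_Mat_class xc yd FF.
move=> [c [cc rc xc]] [d [cd rd yd]] FF.
apply: val_inj; rewrite xc yd; suff -> : c = d by exact: erefl.
apply/rep_iso_eq/rank2_iso => //; apply: F_matroid_bracket_degrees => // m n.
by rewrite -!F_Mat_class -xc -yd; apply: newton_bracket_pi.
Qed.
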